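(* Let $(x^k)_{k\ge 0}$ be generated by the ARock algorithm for a nonexpansive operator $T:\mathbb{H}\to\mathbb{H}$ with at least one fixed point, under the following conditions: 1. The block sequence $i(0),i(1),\ldots$ is a sequence of IID random variables, uniform on $\{1,\ldots,m\}$. 2. The sequence of delay vectors $\vec{j}(0),\vec{j}(1),\ldots$ is an evenly old, IID sequence that is independent of the block sequence. 3. $\epsilon_1,\epsilon_2,\ldots\in(0,\infty)$ is an arbitrary sequence of parameters such that $\sum_{i=1}^{\infty}\frac{1}{\epsilon_i}<\infty$ and $\sum_{l=1}^{\infty}\epsilon_lP_l\,l<\infty$, where $P_l=\mathbb{P}[j(k)\ge l]$. 4. The step size is $\eta^k=ch$ for an arbitrary fixed $c\in(0,1)$ and $$h=\left(1+\frac{1}{m}\sum_{l=1}^{\infty}\epsilon_lP_l+\sum_{i=1}^{\infty}\frac{1}{\epsilon_i}\right)^{-1}.$$ Then with probability $1$ the sequence of ARock iterates converges weakly to a solution (a point of $\mathrm{Fix}(T)$).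
   Context: $\mathbb{H}$ is a separable Hilbert space, decomposed into $m$ orthogonal subspaces $\mathbb{H}=\mathbb{H}_1\times\cdots\times\mathbb{H}_m$; write $x=(x_1,\ldots,x_m)$ with $x_i\in\mathbb{H}_i$. $T:\mathbb{H}\to\mathbb{H}$ is nonexpansive: $\|Tx-Ty\|\le\|x-y\|$. $\mathrm{Fix}(T)$ is its set of fixed points; a solution is an element of $\mathrm{Fix}(T)$. $S=I-T$, and $S_ix$ is the $i$-th block of $Sx$. $\mathbb{N}=\{0,1,2,\ldots\}$. ARock algorithm: given a starting point $x^0\in\mathbb{H}$, step lengths $\eta^0,\eta^1,\ldots$, block indices $i(k)\in\{1,\ldots,m\}$ and delay vectors $\vec{j}(k)=(j(k,1),\ldots,j(k,m))\in\mathbb{N}^m$, define for $k=0,1,2,\ldots$ and $i=1,\ldots,m$: $x_i^{k+1}=x_i^k-\eta^kS_i(\hat{x}^k)$ if $i=i(k)$, and $x_i^{k+1}=x_i^k$ if $i\ne i(k)$. The delayed iterate is $\hat{x}^k=x^{k-\vec{j}(k)}$, where $x^{k-\vec{j}}=(x_1^{k-j_1},\ldots,x_m^{k-j_m})$ and $x^n=x^0$ for $n<0$. The current delay is $j(k)=\max_{1\le i\le m}j(k,i)$. Delays are evenly old if there is a constant $B$ such that, with probability $1$, $|j(k,i)-j(k,l)|\le B$ for all $k\in\mathbb{N}$ and $1\le i,l\le m$. Since the delay vectors are IID, $P_l$ does not depend on $k$. *)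

(* Defs.v *)
From HB Require Import structures.
From mathcomp Require Import all_boot all_order all_algebra finmap.
From mathcomp Require Import all_classical all_reals all_analysis.

Set Implicit Arguments.
Unset Strict Implicit.
Unset Printing Implicit Defensive.

Import Order.TTheory GRing.Theory Num.Theory.
Import numFieldNormedType.Exports.

Local Open Scope classical_set_scope.
Local Open Scope ring_scope.

(* A real Hilbert space is a [completeNormedModType R] together with a
   positive definite symmetric form [ip] inducing its norm. Complex Hilbert
   spaces are covered by taking the real part of their inner product: norms
   and weak convergence are unchanged, and orthogonality is kept. *)

Definition inner_product (R : realType) (H : completeNormedModType R)
    (ip : {dot H for idfun}) : Prop :=
  forall u : H, `|u| ^+ 2 = ip u u.

Definition separable (T : topologicalType) : Prop :=
  exists2 D : set T, countable D & dense D.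

(* [V b] is the subspace H_b and [pr b x] the component x_b, seen as an element
   of the ambient space. The conditions determine [pr] from [V] and force each
   [V b] to be closed. *)
Definition orthogonal_decomposition (R : realType) (H : completeNormedModType R)
    (ip : {dot H for idfun}) (m : nat)
    (V : 'I_m -> set H) (pr : 'I_m -> H -> H) : Prop :=
  [/\ forall b, V b 0 /\ forall (a : R) u v, V b u -> V b v -> V b (a *: u + v),
      forall b b' u v, b != b' -> V b u -> V b' v -> ip u v = 0,
      forall b x, V b (pr b x) &
      forall x, x = \sum_(b < m) pr b x].

Definition nonexpansive (R : realType) (H : normedModType R) (T : H -> H) : Prop :=
  forall x y, `|T x - T y| <= `|x - y|.

Definition Fix (H : Type) (T : H -> H) : set H := [set z | T z = z].

Definition weakly_converges (R : realType) (H : completeNormedModType R)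
    (ip : {dot H for idfun}) (x : nat -> H) (z : H) : Prop :=
  forall y : H, ip (x k) y @[k --> \oo] --> ip z y.

Section arock.
Context {R : realType} {H : completeNormedModType R} {m : nat}.
Variable pr : 'I_m -> H -> H.

(* Truncated subtraction in nat implements the convention x^n = x^0 for n < 0. *)
Definition delayed_iterate (x : nat -> H) (k : nat) (j : {ffun 'I_m -> nat}) : H :=
  \sum_(b < m) pr b (x (k - j b)%N).

Definition arock (T : H -> H) (eta : nat -> R) (i : nat -> 'I_m)
    (j : nat -> {ffun 'I_m -> nat}) (x0 : H) (x : nat -> H) : Prop :=
  x 0%N = x0 /\
  forall (k : nat) (b : 'I_m),
    let xhat := delayed_iterate x k (j k) in
    pr b (x k.+1) = if b == i k then pr b (x k) - eta k *: pr b (xhat - T xhat)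
                    else pr b (x k).

End arock.

Definition current_delay (m : nat) (j : {ffun 'I_m -> nat}) : nat :=
  (\max_(b < m) j b)%N.

Section discrete_random_sequences.
Context {d : measure_display} {Omega : measurableType d} {R : realType}.
Variable P : probability Omega R.

(* Countable types are implicitly given the discrete sigma-algebra. *)
Definition random_sequence (A : countType) (X : nat -> Omega -> A) : Prop :=
  forall (k : nat) (B : set A), measurable (X k @^-1` B).

Definition mutually_independent (A : countType) (X : nat -> Omega -> A) : Prop :=
  forall (K : {fset nat}) (B : nat -> set A),
    P (\bigcap_(k in [set` K]) X k @^-1` B k) =
    (\prod_(k <- K) P (X k @^-1` B k))%E.

Definition identically_distributed (A : countType) (X : nat -> Omega -> A) : Prop :=
  forall (k l : nat) (B : set A), P (X k @^-1` B) = P (X l @^-1` B).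

Definition iid (A : countType) (X : nat -> Omega -> A) : Prop :=
  [/\ random_sequence X, mutually_independent X & identically_distributed X].

Definition sigma_of (A : countType) (X : nat -> Omega -> A) : set (set Omega) :=
  <<s [set E | exists k B, E = X k @^-1` B] >>.

Definition independent_sequences (A A' : countType)
    (X : nat -> Omega -> A) (Y : nat -> Omega -> A') : Prop :=
  forall E F, sigma_of X E -> sigma_of Y F -> P (E `&` F) = (P E * P F)%E.

Definition evenly_old (m : nat) (j : nat -> Omega -> {ffun 'I_m -> nat}) : Prop :=
  exists B : nat, {ae P, forall w, forall (k : nat) (b l : 'I_m),
    `|(j k w b)%:Z - (j k w l)%:Z| <= B%:Z}.

(* P_l = P[j(k) >= l], evaluated at k = 0: only used for identically
   distributed delay vectors, for which it does not depend on k. *)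
Definition delay_tail (m : nat) (j : nat -> Omega -> {ffun 'I_m -> nat})
    (l : nat) : R :=
  fine (P [set w | (l <= current_delay (j 0%N w))%N]).

End discrete_random_sequences.

Definition summable_from1 (R : realType) (u : nat -> R) : Prop :=
  cvgn (fun n => \sum_(1 <= l < n) u l).

Definition sum_from1 (R : realType) (u : nat -> R) : R :=
  limn (fun n => \sum_(1 <= l < n) u l).

Definition step_bound (R : realType) (m : nat) (eps Pl : nat -> R) : R :=
  (1 + m%:R^-1 * sum_from1 (fun l => eps l * Pl l)
     + sum_from1 (fun l => (eps l)^-1))^-1.

(* Main.v *)
(* The iterates take countably many values, so the filtration generated by
   blocks and delays is atomic and conditional expectations reduce to sums over
   atoms. For a fixed point z, cocoercivity of S = I - T and Young's inequality
   with weights eps_l make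
     xi_k = |x^k - z|^2 + (1/m) sum_(l >= 1) c_l |x^(k+1-l) - x^(k-l)|^2,
   where c_l = sum_(n >= l) eps_n P_n, a nonnegative supermartingale whose drift
   is at most -(eta/m) (1 - c) E[|S xhat^k|^2 | past]. Hence S xhat^k -> 0 a.s.
   and, since sum_l c_l < oo, |x^k - z| converges a.s.

   The delay j(k) is independent of the past, so for a fixed delay vector v with
   P[j(k) = v] > 0 the quantities S x^(k-v) are square summable a.s. too. As v
   is fixed and x^(k+1) - x^k -> 0, this gives S x^k -> 0.

   For a bounded sequence with S x^k -> 0, the asymptotic center (the minimizer
   of p |-> limsup |x^k - p|^2) is a fixed point, and so are the centers of its
   subsequences. As |x^k - p| converges for every fixed point p, all of them
   minimize the same function on Fix T, which forces weak convergence without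
   any appeal to weak compactness. *)

Require Import Defs.
From HB Require Import structures.
From mathcomp Require Import all_boot all_order all_algebra.
From mathcomp Require Import all_classical all_reals all_analysis.
From mathcomp Require Import measurable_realfun finmap ring lra.

Set Implicit Arguments.
Unset Strict Implicit.
Unset Printing Implicit Defensive.

Import Order.TTheory GRing.Theory Num.Theory.
Import numFieldNormedType.Exports.

Local Open Scope classical_set_scope.
Local Open Scope ring_scope.

(** * Geometry of Hilbert spaces *)

Section inner_product_theory.
Context {R : realType} {H : completeNormedModType R} (ip : {dot H for idfun}).
Hypothesis hip : inner_product ip.

Lemma ipC u v : ip u v = ip v u.
Proof. by rewrite hermC /= expr0 mul1r. Qed.

Lemma ipZl a u v : ip (a *: u) v = a * ip u v.
Proof. by rewrite linearZl_LR. Qed.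

Lemma ipZr a u v : ip u (a *: v) = a * ip u v.
Proof. by rewrite ipC ipZl ipC. Qed.

Lemma sqr_normD u v : `|u + v| ^+ 2 = `|u| ^+ 2 + 2 * ip u v + `|v| ^+ 2.
Proof. by rewrite !hip linearDl !linearDr /= (ipC v u); ring. Qed.

Lemma sqr_normB u v : `|u - v| ^+ 2 = `|u| ^+ 2 - 2 * ip u v + `|v| ^+ 2.
Proof. by rewrite sqr_normD linearNr normrN; ring. Qed.

(** Young's inequality with a free weight, read off by expanding the nonnegative quantity
    [a^-1 * |u - a *: v|^2]. *)
Lemma ip_bound a u v : 0 < a -> 2 * ip u v <= a^-1 * `|u| ^+ 2 + a * `|v| ^+ 2.
Proof.
move=> a0; have : 0 <= a^-1 * `|u - a *: v| ^+ 2.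
  by rewrite mulr_ge0 ?sqr_ge0// invr_ge0 ltW.
rewrite sqr_normB ipZr normrZ gtr0_norm// exprMn.
have -> : a^-1 * (`|u| ^+ 2 - 2 * (a * ip u v) + a ^+ 2 * `|v| ^+ 2) =
  a^-1 * `|u| ^+ 2 - 2 * ip u v + a * `|v| ^+ 2 by field; rewrite gt_eqF.
lra.
Qed.

(** Expand the square of [T y - z = (y - z) - (y - T y)] and compare with [|T y - z| <= |y - z|]:
    cocoercivity of [I - T], tested against a fixed point. *)
Lemma nonexpansive_cocoercive (T : H -> H) z y : nonexpansive T -> T z = z ->
  `|y - T y| ^+ 2 <= 2 * ip (y - T y) (y - z).
Proof.
move=> nT Tz; have := nT y z; rewrite Tz -ler_sqr ?nnegrE// => h.
suff : `|T y - z| ^+ 2 =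
    `|y - z| ^+ 2 - 2 * ip (y - T y) (y - z) + `|y - T y| ^+ 2 by lra.
have -> : T y - z = (y - z) - (y - T y).
  by rewrite opprB [RHS]addrC addrA subrK.
by rewrite sqr_normB ipC.
Qed.

(** A form of the parallelogram law; the negative term is the uniform convexity that forces
    near-minimizers of an asymptotic radius together. *)
Lemma sqr_norm_midpoint (p q u : H) :
  `|u - 2^-1 *: (p + q)| ^+ 2 =
  2^-1 * `|u - p| ^+ 2 + 2^-1 * `|u - q| ^+ 2 - 4^-1 * `|p - q| ^+ 2.
Proof.
have -> : p - q = (u - q) - (u - p).
  by rewrite opprB [RHS]addrC addrA subrK.
have -> : u - 2^-1 *: (p + q) = 2^-1 *: (u - p) + 2^-1 *: (u - q).
  rewrite -scalerDr addrACA -opprD scalerBr; congr (_ - _).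
  by rewrite -mulr2n -(scaler_nat 2 u) scalerA mulVf ?pnatr_eq0// scale1r.
rewrite sqr_normD (sqr_normB (u - q)) !normrZ ipZl ipZr ger0_norm ?invr_ge0//.
rewrite (ipC (u - q)) !exprMn.
by field.
Qed.

(** * Orthogonal block decompositions *)

Section decomposition.
Context {m : nat} {V : 'I_m -> set H} {pr : 'I_m -> H -> H}.
Hypothesis hdec : orthogonal_decomposition ip V pr.

Lemma pr_sum x : \sum_(b < m) pr b x = x.
Proof. by case: hdec. Qed.

Lemma pr_orth b b' x y : b != b' -> ip (pr b x) (pr b' y) = 0.
Proof. by move=> nb; case: hdec => _ o p _; exact: (o _ _ _ _ nb). Qed.

Lemma V_lin b : V b 0 /\ forall a u v, V b u -> V b v -> V b (a *: u + v).
Proof. by case: hdec. Qed.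

(** Pairing [f b - g b] with the vanishing sum of all differences kills the other blocks by
    orthogonality and leaves its squared norm. *)
Lemma sum_V_inj (f g : 'I_m -> H) : (forall b, V b (f b)) ->
  (forall b, V b (g b)) -> \sum_b f b = \sum_b g b -> f =1 g.
Proof.
move=> Vf Vg e b; apply/eqP; rewrite -subr_eq0 -normr_eq0 -sqrf_eq0 hip.
have -> : ip (f b - g b) (f b - g b) = ip (\sum_b' (f b' - g b')) (f b - g b).
  have [_ o _ _] := hdec.
  have VB b' : V b' (f b' - g b').
    by rewrite addrC -scaleN1r; apply: (V_lin b').2.
  rewrite linear_sumlz (bigD1 b)//= big1 ?addr0// => b' nb.
  exact: (o _ _ _ _ nb (VB b') (VB b)).
by rewrite sumrB e subrr linear0l.
Qed.

Lemma pr_eq (f : 'I_m -> H) x : (forall b, V b (f b)) -> \sum_b f b = x ->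
  forall b, pr b x = f b.
Proof.
move=> Vf e b; apply: (@sum_V_inj (pr ^~ x) f) => //; first by case: hdec.
by rewrite e pr_sum.
Qed.

(** Linearity is not assumed of [pr]: the right-hand sides lie in the subspaces and add up to
    [a *: x + y], so uniqueness of components applies. *)
Lemma prP a x y b : pr b (a *: x + y) = a *: pr b x + pr b y.
Proof.
apply: (@pr_eq (fun b => a *: pr b x + pr b y)).
  by move=> b'; have [_ _ p _] := hdec; apply: (V_lin b').2.
by rewrite big_split/= -scaler_sumr !pr_sum.
Qed.

Lemma prD x y b : pr b (x + y) = pr b x + pr b y.
Proof. by rewrite -{1}[x]scale1r prP scale1r. Qed.

Lemma pr0 b : pr b 0 = 0.
Proof. by apply: (@pr_eq (fun=> 0)); [move=> ?; exact: (V_lin _).1|rewrite big1]. Qed.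

Lemma prN x b : pr b (- x) = - pr b x.
Proof. by rewrite -scaleN1r -[_ *: x]addr0 prP pr0 addr0 scaleN1r. Qed.

Lemma prB x y b : pr b (x - y) = pr b x - pr b y.
Proof. by rewrite prD prN. Qed.

Lemma ip_pr x y b : ip (pr b x) (pr b y) = ip (pr b x) y.
Proof.
rewrite -[in RHS](pr_sum y) linear_sumr/= (bigD1 b)//= big1 ?addr0// => b' nb.
by rewrite pr_orth// eq_sym.
Qed.

Lemma sqr_norm_pr x : \sum_b `|pr b x| ^+ 2 = `|x| ^+ 2.
Proof.
rewrite [RHS]hip -[X in ip _ X](pr_sum x) linear_sumr/=; apply: eq_bigr => b _.
by rewrite hip ip_pr ipC.
Qed.

Lemma sqr_norm_sum_pr (A : pred 'I_m) (x : 'I_m -> H) :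
  `|\sum_(b | A b) pr b (x b)| ^+ 2 = \sum_(b | A b) `|pr b (x b)| ^+ 2.
Proof.
rewrite hip linear_sumlz; apply: eq_bigr => b Ab.
rewrite /= linear_sumr/= (bigD1 b)//= big1 ?addr0 ?hip// => b' /andP[_ nb].
by rewrite pr_orth// eq_sym.
Qed.

Lemma norm_pr x b : `|pr b x| <= `|x|.
Proof.
rewrite -ler_sqr ?nnegrE// -(sqr_norm_pr x) (bigD1 b)//= lerDl.
by apply: sumr_ge0 => *; exact: sqr_ge0.
Qed.

End decomposition.
End inner_product_theory.

(** * Asymptotic centers and weak convergence *)

Section asymptotic_center.
Context {R : realType} {H : completeNormedModType R} (ip : {dot H for idfun}).
Hypothesis hip : inner_product ip.

(* The limit superior of |y n - p|^2. *)
Definition asymptotic_radius (y : nat -> H) (p : H) : R :=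
  inf [set r | \forall n \near \oo, `|y n - p| ^+ 2 <= r].

Section bounded.
Variables (y : nat -> H) (M : R).
Hypothesis yM : forall n, `|y n| <= M.
Local Notation phi := (asymptotic_radius y).

Lemma asymptotic_radius_le p r :
  (\forall n \near \oo, `|y n - p| ^+ 2 <= r) -> phi p <= r.
Proof.
move=> h; apply: ge_inf => //; exists 0 => s /= /filter_ex[n]; apply: le_trans.
exact: sqr_ge0.
Qed.

Lemma asymptotic_radius_near p r : phi p < r ->
  \forall n \near \oo, `|y n - p| ^+ 2 <= r.
Proof.
move=> pr; have : has_inf [set r | \forall n \near \oo, `|y n - p| ^+ 2 <= r].
  split; last first.
    by exists 0 => s /= /filter_ex[n]; apply: le_trans; exact: sqr_ge0.
  exists ((M + `|p|) ^+ 2); near=> n.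
  rewrite ler_sqr ?nnegrE//; last by rewrite addr_ge0// (le_trans _ (yM 0)).
  by rewrite (le_trans (ler_normB _ _))// lerD2r.
move=> /(@inf_adherent _ _ (r - phi p)); rewrite subr_gt0 => /(_ pr)[s /= hs].
rewrite -/(phi p) addrC subrK => sr; apply: filterS hs => n /le_trans; apply.
exact: ltW.
Unshelve. all: by end_near. Qed.

Lemma asymptotic_radius_ge0 p : 0 <= phi p.
Proof.
apply/ler_addgt0Pr => e e0.
have : phi p < phi p + e by rewrite ltrDl.
by move=> /asymptotic_radius_near/filter_ex[n]; apply: le_trans; exact: sqr_ge0.
Qed.

(** With [t = |y n - p|], expand [(t + e)^2] and use [2 * t <= 1 + t^2] and [t^2 <= phi p + e]; the
    [4] gathers the remaining terms in [e] and [e^2 <= e]. *)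
Lemma asymptotic_radius_perturb p q e : 0 < e <= 1 ->
  (\forall n \near \oo, `|y n - q| <= `|y n - p| + e) ->
  phi q <= phi p + e * (phi p + 4).
Proof.
move=> /andP[e0 e1] h; apply: asymptotic_radius_le.
have : phi p < phi p + e by rewrite ltrDl.
move=> /asymptotic_radius_near; apply: filterS2 h => n h1 h2.
apply: (@le_trans _ _ ((`|y n - p| + e) ^+ 2)).
  by rewrite ler_sqr// ?nnegrE// addr_ge0// ltW.
have h0 := asymptotic_radius_ge0 p.
set t := `|y n - p| in h2 *; set f := phi p in h0 h2 *.
have ht : 2 * t <= 1 + (f + e).
  by have := sqr_ge0 (t - 1); rewrite sqrrB1; lra.
have ee : e * e <= e * 1 by rewrite ler_wpM2l// ltW.
have := ler_wpM2l (ltW e0) ht.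
have : e * e <= e by rewrite mulr1 in ee.
rewrite sqrrD expr2; lra.
Qed.

(** The midpoint has radius at least [d], while [sqr_norm_midpoint] bounds it by the mean of the two
    radii minus [4^-1 * |p - q|^2]. Hence near-minimizers are close and minimizers are unique. *)
Lemma asymptotic_radius_midpoint p q d : (forall u, d <= phi u) ->
  `|p - q| ^+ 2 <= 2 * phi p + 2 * phi q - 4 * d.
Proof.
move=> hd; apply/ler_addgt0Pr => e e0.
have e4 : 0 < e / 4 by rewrite divr_gt0.
have hp : phi p < phi p + e / 4 by rewrite ltrDl.
have hq : phi q < phi q + e / 4 by rewrite ltrDl.
suff : phi (2^-1 *: (p + q)) <= 2^-1 * (phi p + e / 4) + 2^-1 * (phi q + e / 4)
    - 4^-1 * `|p - q| ^+ 2 by have := hd (2^-1 *: (p + q)); lra.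
apply: asymptotic_radius_le.
move: hp hq => /asymptotic_radius_near hp /asymptotic_radius_near.
apply: filterS2 hp => n hp hq.
by rewrite (sqr_norm_midpoint hip); lra.
Qed.

(** The midpoint inequality makes a minimizing sequence Cauchy; completeness gives its limit, and
    the perturbation bound shows that the limit is a minimizer. *)
Lemma asymptotic_center : exists z, forall p, phi z <= phi p.
Proof.
pose d := inf (range phi).
have hd u : d <= phi u.
  apply: ge_inf; last by exists u.
  by exists 0 => _ [v _ <-]; exact: asymptotic_radius_ge0.
have d0 : 0 <= d.
  apply: lb_le_inf; first by exists (phi 0), 0.
  by move=> _ [v _ <-]; exact: asymptotic_radius_ge0.
have ex n : exists p, phi p < d + n.+1%:R^-1.
  have [||_ [p _ <-] h] := @inf_adherent _ (range phi) n.+1%:R^-1; last by exists p.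
    by rewrite invr_gt0.
  split; first by exists (phi 0), 0.
  by exists 0 => _ [v _ <-]; exact: asymptotic_radius_ge0.
have [p hp] := choice ex.
have dist n k : `|p n - p k| ^+ 2 <= 2 * n.+1%:R^-1 + 2 * k.+1%:R^-1.
  apply: le_trans (asymptotic_radius_midpoint (p n) (p k) hd) _.
  by move: (hp n) (hp k); set a := n.+1%:R^-1; set b := k.+1%:R^-1; lra.
have /cvg_ex[z pz] : cvg (p @ \oo).
  apply: cauchy_cvg; apply: cauchy_exP => e e0.
  have e20 : 0 < e ^+ 2 / 4 by rewrite divr_gt0// exprn_gt0.
  have [N _ hN] := near_infty_natSinv_lt (PosNum e20).
  exists (p N), N => // n Nn; rewrite /= -ball_normE/= /ball_ /=.
  rewrite -ltr_sqr ?nnegrE ?(ltW e0)//; apply: le_lt_trans (dist N n) _.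
  move: (hN N (leqnn _)) (hN n Nn) => /=.
  by set a := N.+1%:R^-1; set b := n.+1%:R^-1; lra.
exists z => q; apply: le_trans (hd q).
apply/ler_addgt0Pr => e e0.
(* For a suitable [n], [phi (p n)] is within [e'] of [d] and [p n] within [e'] of [z]; the errors
   are [e'] and at most [e' * (d + 5)], hence [d + 6]. *)
pose e' := Num.min 1 (e / (d + 6)).
have d6 : 0 < d + 6 by rewrite ltr_wpDl.
have e'0 : 0 < e' by rewrite lt_min ltr01 divr_gt0.
have e'1 : e' <= 1 by rewrite ge_min lexx.
have e'2 : e' * (d + 6) <= e by rewrite -ler_pdivlMr// ge_min lexx orbT.
have [N _ hN] := near_infty_natSinv_lt (PosNum e'0).
have [n [nN pn]] : exists n, (N <= n)%N /\ `|z - p n| <= e'.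
  have /cvgrPdist_le/(_ _ e'0) := pz.
  by move=> /(filterI (nbhs_infty_ge N))/filter_ex[n [? ?]]; exists n.
have /= := hN n nN => h1; have := hp n; move: h1; set a := n.+1%:R^-1 => h1 h2.
have h3 : phi z <= phi (p n) + e' * (phi (p n) + 4).
  apply: asymptotic_radius_perturb; first by rewrite e'0.
  near=> k; rewrite (le_trans _ (_ : `|y k - p n| + `|p n - z| <= _))//.
    by rewrite (le_trans _ (ler_normD _ _))// addrA subrK.
  by rewrite lerD2l distrC.
have h4 := asymptotic_radius_ge0 (p n).
apply: le_trans h3 _.
have : e' * (phi (p n) + 4) <= e' * (d + 1 + 4).
  by rewrite ler_wpM2l ?(ltW e'0)//; lra.
have -> : e' * (d + 1 + 4) = e' * (d + 6) - e' by ring.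
lra.
Unshelve. all: by end_near. Qed.

(** Since [|y n - T z| <= |y n - z| + |y n - T (y n)|] with vanishing last term, the radius at [T z]
    is no larger than at [z], and two minimizers coincide. *)
Lemma asymptotic_center_fixed (T : H -> H) z : nonexpansive T ->
  (y n - T (y n)) @[n --> \oo] --> 0 -> (forall p, phi z <= phi p) -> T z = z.
Proof.
move=> nT Sy hz.
have TzP : phi (T z) <= phi z.
  apply/ler_addgt0Pr => e e0.
  have d4 : 0 < phi z + 4 by rewrite ltr_wpDl// asymptotic_radius_ge0.
  pose e' := Num.min 1 (e / (phi z + 4)).
  have e'0 : 0 < e' by rewrite lt_min ltr01 divr_gt0.
  have e'1 : e' <= 1 by rewrite ge_min lexx.
  have e'2 : e' * (phi z + 4) <= e by rewrite -ler_pdivlMr// ge_min lexx orbT.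
  apply: (@le_trans _ _ (phi z + e' * (phi z + 4))); last by rewrite lerD2l.
  apply: asymptotic_radius_perturb; first by rewrite e'0.
  move/cvgr0Pnorm_le : Sy => /(_ _ e'0); apply: filterS => n Sn.
  have -> : y n - T z = (T (y n) - T z) + (y n - T (y n)).
    by rewrite [RHS]addrC addrA subrK.
  by rewrite (le_trans (ler_normD _ _))// lerD// nT.
have := asymptotic_radius_midpoint z (T z) hz => h.
have : `|z - T z| ^+ 2 <= 0 by apply: le_trans h _; lra.
by rewrite exprn_even_le0//= normr_eq0 subr_eq0 => /eqP.
Qed.

Lemma asymptotic_radius_cvg p (l : R) : `|y n - p| @[n --> \oo] --> l -> phi p = l ^+ 2.
Proof.
move=> yl.
have y2 : `|y n - p| ^+ 2 @[n --> \oo] --> l ^+ 2 by rewrite expr2; under eq_fun do rewrite expr2; exact: cvgM.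
apply/eqP; rewrite eq_le; apply/andP; split; apply/ler_addgt0Pr => e e0.
  apply: asymptotic_radius_le; move/cvgrPdist_le : y2 => /(_ _ e0).
  by apply: filterS => n; rewrite distrC ler_norml => /andP[_]; rewrite lerBlDl.
have e2 : 0 < e / 2 by rewrite divr_gt0.
have : phi p < phi p + e / 2 by rewrite ltrDl.
move/cvgrPdist_le : y2 => /(_ _ e2) h /asymptotic_radius_near.
move=> /(filterI h)/filter_ex[n [/= ]].
by rewrite ler_norml => /andP[_]; lra.
Qed.

(** Otherwise moving [z] by [t *: u] would lower the radius: the linear gain [2 * t * e] beats the
    quadratic cost [t^2 * |u|^2 <= t * e] plus the slack [t * e / 2]. *)
Lemma asymptotic_center_ip z u e : (forall p, phi z <= phi p) -> 0 < e ->
  ~ \forall n \near \oo, e <= ip (y n - z) u.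
Proof.
move=> hz e0 hn.
pose t := e / (`|u| ^+ 2 + 1).
have u1 : 0 < `|u| ^+ 2 + 1 by rewrite ltr_wpDl// sqr_ge0.
have t0 : 0 < t by rewrite divr_gt0.
have tu : t * `|u| ^+ 2 <= e.
  by rewrite mulrAC ler_pdivrMr// ler_wpM2l ?ltW// ltrDl.
have te : 0 < t * e by rewrite mulr_gt0.
have : phi z < phi z + t * e / 2 by rewrite ltrDl divr_gt0.
move=> /asymptotic_radius_near h1.
have : phi (z + t *: u) <= phi z + t * e / 2 - 2 * (t * e) + t * (t * `|u| ^+ 2).
  apply: asymptotic_radius_le; apply: filterS2 hn h1 => n h2 h3.
  rewrite opprD addrA (sqr_normB hip) (ipZr ip) normrZ exprMn (gtr0_norm t0).
  by have := ler_wpM2l (ltW t0) h2; lra.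
have : t * (t * `|u| ^+ 2) <= t * e by rewrite ler_wpM2l// ltW.
have := hz (z + t *: u); lra.
Qed.

End bounded.
End asymptotic_center.

Lemma not_near_infty (Q : nat -> Prop) : ~ (\forall n \near \oo, Q n) ->
  forall N, exists2 n, (N <= n)%N & ~ Q n.
Proof.
move=> nQ N; apply: contrapT => h; apply: nQ.
near=> n; apply: contrapT => nQn; apply: h; exists n => //.
by near: n; exact: nbhs_infty_ge.
Unshelve. all: by end_near. Qed.

Lemma cvg_subseq_ge (T : topologicalType) (u : nat -> T) (l : T) (s : nat -> nat) :
  (forall n, (n <= s n)%N) -> u @ \oo --> l -> (u \o s) @ \oo --> l.
Proof.
move=> sn ul; apply: cvg_comp ul => A [N _ NA]; exists N => // n /= Nn.
by apply: NA => /=; rewrite (leq_trans Nn).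
Qed.

Section weak_convergence.
Context {R : realType} {H : completeNormedModType R} (ip : {dot H for idfun}).
Hypothesis hip : inner_product ip.

(* Asymptotic centers of subsequences are fixed points, and on Fix T the
   asymptotic radius is the same for every subsequence. *)
Lemma weak_cvg_of_dist_cvg (T : H -> H) (x : nat -> H) : nonexpansive T ->
  Fix T !=set0 -> (x n - T (x n)) @[n --> \oo] --> 0 ->
  (forall z, Fix T z -> cvgn (fun n => `|x n - z|)) ->
  exists2 z, Fix T z & weakly_converges ip x z.
Proof.
move=> nT [z0 Fz0] Sx hx.
have [M xM] : exists M, forall n, `|x n| <= M.
  have /cvg_seq_bounded/pinfty_ex_gt0[M M0 hM] := hx _ Fz0.
  exists (M + `|z0|) => n; rewrite -[x n](subrK z0).
  rewrite (le_trans (ler_normD _ _))// lerD2r.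
  by have := hM n Logic.I; rewrite /= normr_id.
have [z hz] := asymptotic_center hip xM.
have Fz := asymptotic_center_fixed hip xM nT Sx hz.
exists z => // u; apply/cvgrPdist_le => e e0; apply: contrapT => hu.
(* One-sided bounds for [u] and [- u] together give the two-sided one, so some one-sided bound
   fails. *)
have [u' hu'] : exists u', ~ \forall n \near \oo, ip (x n - z) u' <= e.
  apply: contrapT => hn; apply: hu.
  have h v : \forall n \near \oo, ip (x n - z) v <= e.
    by apply: contrapT => hv; apply: hn; exists v.
  apply: filterS2 (h u) (h (- u)) => n; rewrite linearNr !linearBl /= => h1 h2.
  by rewrite ler_norml; lra.
have ex N : exists n, (N <= n)%N /\ e <= ip (x n - z) u'.
  have [n Nn /negP] := not_near_infty hu' N.
  by rewrite -ltNge => /ltW; exists n.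
have [s /all_and2[sN se]] := choice ex.
pose y := x \o s.
have yM n : `|y n| <= M by exact: xM.
have Sy : (y n - T (y n)) @[n --> \oo] --> 0 by exact: (cvg_subseq_ge sN Sx).
have [z' hz'] := asymptotic_center hip yM.
have Fz' := asymptotic_center_fixed hip yM nT Sy hz'.
have radius p : Fix T p -> asymptotic_radius y p = asymptotic_radius x p.
  move=> /hx/cvg_ex[l xl].
  rewrite (asymptotic_radius_cvg xM xl).
  exact: (asymptotic_radius_cvg yM (cvg_subseq_ge sN xl)).
(* [z] is also a center of the subsequence: its radius for [y] equals that for [x], hence is at most
   that of the fixed point [z'], which is minimal for [y]. This contradicts [se]. *)
apply: (@asymptotic_center_ip _ _ _ hip y M yM z u' e) => //.
  by move=> p; rewrite radius// (le_trans (hz z'))// -radius.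
by near=> n; exact: se.
Unshelve. all: by end_near. Qed.

(** The distance to [x n] is 1-Lipschitz uniformly in [n], so convergence passes to the closure.
    This lets countably many fixed points stand for all of them. *)
Lemma cvg_dist_closure (x : nat -> H) (B : set H) z :
  (forall b, B b -> cvgn (fun n => `|x n - b|)) -> closure B z ->
  cvgn (fun n => `|x n - z|).
Proof.
move=> hB clz; apply: cauchy_cvg; apply: cauchy_exP => e e0.
have e3 : 0 < e / 3 by rewrite divr_gt0.
have [b [Bb /=]] := clz _ (nbhsx_ballx z _ e3).
rewrite -ball_normE/= => zb.
have /cvg_ex[l /cvgrPdist_le/(_ _ e3) xl] := hB b Bb.
exists l; apply: filterS xl => n xl; rewrite -ball_normE/=.
have : `| `|x n - b| - `|x n - z| | <= `|z - b|.
  rewrite (le_trans (ler_dist_dist _ _))// opprB addrC addrA addrNK.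
  by rewrite addrC.
move: xl zb; rewrite !ler_norml !ltr_norml; lra.
Qed.

(** For each dense point, coded by [n], and each radius [1/(k+1)], choose a point of [A] that close
    to it if there is one, and [a0] otherwise. *)
Lemma separable_subset (A : set H) : separable H -> A !=set0 ->
  exists2 c : nat -> nat -> H, (forall n k, A (c n k)) &
    A `<=` closure [set c n k | n in setT & k in setT].
Proof.
move=> [D cD dD] [a0 Aa0]; have [f finj] := elimT (countable_injP _) cD.
pose Q n k a := A a /\ exists d, [/\ D d, f d = n & `|a - d| < k.+1%:R^-1].
have ex n k : exists a, A a /\ ((exists a', Q n k a') -> Q n k a).
  have [[a Qa]|nQ] := pselect (exists a, Q n k a); first by exists a; split => //; case: Qa.
  by exists a0; split.
have [c /= hc] := choice (fun nk : nat * nat => ex nk.1 nk.2).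
exists (fun n k => c (n, k)) => [n k|a Aa B]; first by case: (hc (n, k)).
rewrite -nbhs_ballE => -[e /= e0 eB].
have e2 : 0 < e / 2 by rewrite divr_gt0.
have [k _ /(_ k (leqnn k))/= hk] := near_infty_natSinv_lt (PosNum e2).
have k0 : 0 < k.+1%:R^-1 :> R by rewrite invr_gt0.
have [d [ad Dd]] : ball a k.+1%:R^-1 `&` D !=set0.
  by apply: dD; [exists a; exact: ballxx|exact: ball_open].
move: ad; rewrite -ball_normE/= => ad.
have [_ [|Ac [d' [Dd' fd' cd]]]] := hc (f d, k).
  by exists a; split => //; exists d.
have {}fd' : d' = d by apply: finj (mem_set Dd') (mem_set Dd) fd'.
exists (c (f d, k)); split; first by exists (f d) => //; exists k.
apply: eB; rewrite -ball_normE/=.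
rewrite -[a](subrK d) -addrA (le_lt_trans (ler_normD _ _))//.
move: cd; rewrite fd' distrC => cd.
by move: ad cd hk; set t := _^-1; lra.
Qed.

End weak_convergence.

(** * Discrete filtrations and supermartingales *)

(** For a countably valued [Z] with measurable fibres, this stands for measurability with respect to
    the sigma-algebra generated by [Z]. *)
Definition determined_by (Omega A B : Type) (Z : Omega -> A) (f : Omega -> B) :=
  forall w w', Z w = Z w' -> f w = f w'.

Section discrete_conditioning.
Context {d : measure_display} {Omega : measurableType d} {R : realType}.
Variable P : probability Omega R.

Definition expect (f : Omega -> R) : \bar R := (\int[P]_w (f w)%:E)%E.

Section one_variable.
Variables (A : countType) (Z : Omega -> A).
Hypothesis mZ : forall a, measurable (Z @^-1` [set a]).

Lemma determined_preimage (B : Type) (f : Omega -> B) (S : set B) :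
  determined_by Z f -> measurable (f @^-1` S).
Proof.
move=> fZ.
have -> : f @^-1` S = \bigcup_(a in Z @` (f @^-1` S)) Z @^-1` [set a].
  apply/seteqP; split=> [w Sw|w [_ [w' Sw' <-] /= e]].
    by exists (Z w) => //; exists w.
  by rewrite /preimage/= (fZ _ _ e).
rewrite bigcup_mkcond; apply: countable_bigcupT_measurable => // a.
by case: ifPn.
Qed.

Lemma determined_measurable (f : Omega -> R) :
  determined_by Z f -> measurable_fun setT (EFin \o f).
Proof.
move=> fZ; apply/measurable_EFinP => _ Y mY; rewrite setTI.
exact: determined_preimage.
Qed.

(** Atoms of [Z] are numbered by [pickle] codes, so that the decomposition is a series over the
    naturals; codes of no attained value give empty pieces. *)
Lemma integral_on_atoms (f : Omega -> R) (D : set Omega) : measurable D ->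
  determined_by Z f -> (forall w, 0 <= f w) ->
  (\int[P]_(w in D) (f w)%:E =
   \big[+%E/0]_(0 <= n <oo)
     \int[P]_(w in D `&` [set w | @choice.pickle A (Z w) = n]) (f w)%:E)%E.
Proof.
move=> mD fZ f0.
have mF n : measurable [set w | @choice.pickle A (Z w) = n].
  apply: (@determined_preimage _ (fun w => @choice.pickle A (Z w)) [set n]) => w w'.
  by move->.
have DE : D = \bigcup_n (D `&` [set w | @choice.pickle A (Z w) = n]).
  by apply/seteqP; split=> [w Dw|w [n _ []]//]; exists (@choice.pickle A (Z w)).
rewrite [in LHS]DE ge0_integral_bigcup//.
- by move=> n; exact: measurableI.
- by apply: measurable_funTS; exact: determined_measurable.
- by move=> w _; rewrite lee_fin.
- by move=> n k _ _ [w [[_ /= <-] [_ /= <-]]].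
Qed.

(** [f] is constant on each atom of [Z], so independence of [B] from the atoms suffices. This takes
    the place of conditional expectations. *)
Lemma integral_indep (f : Omega -> R) (B : set Omega) : measurable B ->
  determined_by Z f -> (forall w, 0 <= f w) ->
  (forall w, P (B `&` [set w' | Z w' = Z w]) =
             P B * P [set w' | Z w' = Z w])%E ->
  (\int[P]_(w in B) (f w)%:E = P B * expect f)%E.
Proof.
move=> mB fZ f0 PB.
rewrite /expect integral_on_atoms// [in RHS]integral_on_atoms//.
rewrite -[P B]fineK ?fin_num_measure// -nneseriesZl; last first.
  by move=> n _; apply: integral_ge0 => w _; rewrite lee_fin.
apply: eq_eseriesr => n _.
rewrite setTI; set F := [set w | _].
have [[w0 Fw0]|F0] := pselect (exists w0, F w0); last first.
  have -> : F = set0 by rewrite -subset0 => w Fw; apply: F0; exists w.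
  by rewrite setI0 !integral_set0 mule0.
have FE : F = [set w' | Z w' = Z w0].
  apply/seteqP; split=> [w Fw|w /= e]; last by rewrite /F/= e.
  by apply: (pcan_inj choice.pickleK); rewrite Fw Fw0.
have cst_int D : measurable D -> D `<=` F ->
    (\int[P]_(w in D) (f w)%:E = (f w0)%:E * P D)%E.
  move=> mD DF; rewrite -integral_cst//; apply: eq_integral => w /set_mem Dw.
  by rewrite /cst (fZ w w0)//; have := DF _ Dw; rewrite FE.
have mF : measurable F by rewrite FE; exact: mZ.
rewrite cst_int ?cst_int//; [|exact: measurableI].
by rewrite {1 2}FE PB -FE fineK ?fin_num_measure// muleCA.
Qed.

End one_variable.

(** By Tonelli the series has finite expectation, so it is almost surely finite and its terms tend
    to zero. *)
Lemma ae_cvg0_of_summable (f : nat -> Omega -> R) (M : R) :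
  (forall n, measurable_fun setT (EFin \o f n)) -> (forall n w, 0 <= f n w) ->
  (forall n, \sum_(0 <= k < n) expect (f k) <= M%:E)%E ->
  {ae P, forall w, f n w @[n --> \oo] --> 0}.
Proof.
move=> mf f0 hM.
pose G w := (\big[+%E/0]_(0 <= n <oo) (f n w)%:E)%E.
have iG : (\int[P]_w G w <= M%:E)%E.
  rewrite /G integral_nneseries//; last by move=> n w _; rewrite lee_fin.
  apply: lime_le; last by near=> n; exact: hM.
  apply: is_cvg_ereal_nneg_natsum => n _.
  by apply: integral_ge0 => w _; rewrite lee_fin.
have G0 w : (0 <= G w)%E by apply: nneseries_ge0 => n _ _; rewrite lee_fin.
have mG : measurable_fun setT G.
  apply: (@ge0_emeasurable_sum _ _ _ _ (fun n w => (f n w)%:E) predT) => [n w _ _|n _].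
    by rewrite lee_fin.
  exact: mf.
have GI : P.-integrable setT G.
  apply/integrableP; split => //.
  under eq_integral do rewrite gee0_abs//.
  by rewrite (le_lt_trans iG)// ltry.
have := integrable_ae measurableT GI; apply: filterS => w /(_ Logic.I) Gfin.
apply: cvg_series_cvg_0; apply: nondecreasing_is_cvgn.
  exact: nondecreasing_series.
exists (fine (G w)) => _ [n _ <-].
rewrite -lee_fin fineK// /series/= -sumEFin.
by apply: nneseries_lim_ge => k _ _; rewrite lee_fin.
Unshelve. all: by end_near. Qed.

(** By Fatou the lower limit has expectation at most [M], so almost surely the sequence does not
    diverge to infinity. *)
Lemma ae_frequently_bounded (f : nat -> Omega -> R) (M : R) :
  (forall n, measurable_fun setT (EFin \o f n)) -> (forall n w, 0 <= f n w) ->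
  (forall n, expect (f n) <= M%:E)%E ->
  {ae P, forall w, exists r, ~ \forall n \near \oo, r < f n w}.
Proof.
move=> mf f0 hM.
have f0' n w : setT w -> (0 <= (EFin \o f n) w)%E by rewrite lee_fin.
have F := fatou P measurableT mf f0'.
pose G w := limn_einf (fun n => (f n w)%:E).
have M0 : (0 <= M%:E)%E.
  by apply: le_trans (hM 0%N); apply: integral_ge0 => w _; rewrite lee_fin.
have G0 w : (0 <= G w)%E.
  rewrite /G limn_einf_lim; apply: lime_ge; first exact: is_cvg_einfs.
  near=> n; apply: le_ereal_inf_tmp => _ [k _ <-]; by rewrite lee_fin.
have mG : measurable_fun setT G.
  apply: (@measurableT_comp _ _ _ _ _ _ (-%E : \bar R -> \bar R)).
    exact: oppe_measurable.
  apply: (@measurable_fun_limn_esup _ _ _ _ (fun n w => - (f n w)%:E)%E) => n.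
  apply: (@measurableT_comp _ _ _ _ _ _ (-%E : \bar R -> \bar R)) => //.
  exact: mf.
have iG : (\int[P]_w G w <= M%:E)%E.
  apply: le_trans F _; rewrite limn_einf_lim; apply: lime_le.
    exact: is_cvg_einfs.
  near=> n; apply: ge_ereal_inf; exists (expect (f n)); last exact: hM.
  by exists n => /=.
have GI : P.-integrable setT G.
  apply/integrableP; split => //.
  under eq_integral do rewrite gee0_abs//.
  by rewrite (le_lt_trans iG)// ltry.
have := integrable_ae measurableT GI; apply: filterS => w /(_ Logic.I) Gfin.
apply: contrapT => hn; move: Gfin.
suff -> : G w = +oo%E by [].
have [] // := @cvg_limn_einf_sup _ (fun n => (f n w)%:E) +oo%E _.
apply/cvgeyPgt => r; apply: contrapT => hr; apply: hn; exists r => hr'.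
by apply: hr; apply: filterS hr' => n; rewrite lte_fin.
Unshelve. all: by end_near. Qed.

End discrete_conditioning.

(** * Upcrossings of a real sequence *)

Section upcrossings.
Context {R : realType}.
Implicit Types (a b : R) (u : nat -> R).

(* Buy when u falls to a, sell when it reaches b. *)
Fixpoint holding a b u n : bool :=
  if n is n'.+1 then
    if holding a b u n' then u n < b else u n <= a
  else u 0%N <= a.

Definition sells a b u n : bool := holding a b u n && (b <= u n.+1).

(* Starting from at most a, each completed upcrossing gains b - a; keeping the
   idle amount a in the capital makes it nonnegative, so that no signed
   expectations are needed. *)
Definition trading_capital a b u n : R :=
  (b - a) * \sum_(0 <= k < n) (sells a b u k)%:R + (if holding a b u n then u n else a).

(** Selling books [b - a] and returns to the idle amount [a], in total [b <= u n.+1]; buying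
    replaces [a] by [u n.+1 <= a]. The other cases are equalities. *)
Lemma trading_capitalS a b u n :
  trading_capital a b u n.+1 <=
  (b - a) * \sum_(0 <= k < n) (sells a b u k)%:R
    + (if holding a b u n then u n.+1 else a).
Proof.
rewrite /trading_capital big_nat_recr//= mulrDr -addrA lerD2l /sells.
case: (holding a b u n) => /=.
  by case: (ltP (u n.+1) b) => h /=; rewrite ?mulr0 ?mulr1 ?add0r ?subrK.
by rewrite mulr0 add0r; case: ifP.
Qed.

Lemma holding_lt a b u n : a < b -> holding a b u n -> u n < b.
Proof.
move=> ab; case: n => [|n] /=; first by move=> h; exact: le_lt_trans ab.
by case: ifP => // _ h; exact: le_lt_trans ab.
Qed.

Lemma holding_determined (a b : R) (u v : nat -> R) n :
  (forall k, (k <= n)%N -> u k = v k) -> holding a b u n = holding a b v n.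
Proof.
elim: n => [|n IH] uv /=; first by rewrite uv.
by rewrite IH ?uv// => k kn; rewrite uv// leqW.
Qed.

(** Past the last sale, a value at most [a] puts the trader in a holding that never ends, and [u] is
    below [b] while held. *)
Lemma finitely_many_upcrossings a b u : a < b ->
  (\forall n \near \oo, ~~ sells a b u n) ->
  ~ (\forall n \near \oo, a < u n) -> \forall n \near \oo, u n < b.
Proof.
move=> ab [N _ hN] na.
have [n Nn un] : exists2 n, (N <= n)%N & u n <= a.
  apply: contrapT => h; apply: na; exists N => // n /= Nn.
  by rewrite ltNge; apply/negP => un; apply: h; exists n.
have hold0 : holding a b u n.
  case: n un {Nn} => [//|n un] /=; case: ifP => // _.
  exact: le_lt_trans ab.
exists n => // k /= nk; apply: (holding_lt ab).
elim: k nk => [|k IH]; first by rewrite leqn0 => /eqP <-.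
rewrite leq_eqVlt => /predU1P[<-//|]; rewrite ltnS => nk.
have := hN k (leq_trans Nn nk); rewrite /sells/= IH//=.
by rewrite -ltNge.
Qed.

(** The limit is the lower limit, written [sup S] and finite by the second hypothesis; the absence
    of late upcrossings keeps [u] from staying above it. *)
Lemma cvg_of_finitely_many_upcrossings u : (forall n, 0 <= u n) ->
  (exists r, ~ \forall n \near \oo, r < u n) ->
  (forall p q : rat, 0 <= p < q ->
     \forall n \near \oo, ~~ sells (ratr p) (ratr q) u n) ->
  cvgn u.
Proof.
move=> u0 [r hr] hpq.
(* Two rationals strictly between [x] and [y] reduce this to the given countable family of bands;
   [0 <= x] makes them nonnegative. *)
have key (x y : R) : 0 <= x -> x < y ->
    ~ (\forall n \near \oo, x < u n) -> \forall n \near \oo, u n < y.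
  move=> x0 xy hx.
  have xm : x < (x + y) / 2 by lra.
  have my : (x + y) / 2 < y by lra.
  have [p] := rat_in_itvoo xm; rewrite in_itv/= => /andP[xp pm].
  have [q] := rat_in_itvoo my; rewrite in_itv/= => /andP[mq qy].
  have pq : p < q by rewrite -(ltr_rat R) (lt_trans pm).
  have p0 : 0 <= p by rewrite -(ler_rat R) rmorph0 (le_trans x0)// ltW.
  have := hpq p q; rewrite p0 pq => /(_ isT) /finitely_many_upcrossings.
  rewrite ltr_rat => /(_ pq) h.
  have {}h : \forall n \near \oo, u n < ratr q.
    by apply: h => hp; apply: hx; apply: filterS hp => n; exact: lt_trans.
  by apply: filterS h => n un; exact: lt_trans qy.
pose S := [set x | \forall n \near \oo, x < u n].
have r0 : 0 <= r.
  by rewrite leNgt; apply/negP => r0; apply: hr; near=> n; rewrite (lt_le_trans r0).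
have rr : r < r + 1 by rewrite ltrDl.
have ub := key _ _ r0 rr hr.
have hS : has_sup S.
  split; first by exists (-1); near=> n; rewrite (lt_le_trans _ (u0 n))// ltrN10.
  exists (r + 1) => x /= hx; near \oo => n.
  have h1 : x < u n by near: n.
  by apply/ltW/(lt_trans h1); near: n.
have l0 : 0 <= sup S.
  apply/ler_addgt0Pr => e e0; rewrite -lerBlDr sub0r; apply: ub_le_sup; first by case: hS.
  by near=> n; rewrite (lt_le_trans _ (u0 n))// oppr_lt0.
apply/cvg_ex; exists (sup S); apply/cvgrPdist_le => e e0.
have [x /= hx lx] := sup_adherent e0 hS.
have e2 : 0 < e / 2 by rewrite divr_gt0.
have : \forall n \near \oo, u n < sup S + e.
  apply: (key (sup S + e / 2)); [by rewrite addr_ge0// ltW|lra|].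
  move=> h; have : sup S + e / 2 <= sup S by apply: ub_le_sup => //; case: hS.
  lra.
apply: filterS2 hx => n h1 h2; rewrite ler_norml; lra.
Unshelve. all: by end_near. Qed.

End upcrossings.

Section expectation.
Context {d : measure_display} {Omega : measurableType d} {R : realType}.
Variable P : probability Omega R.
Local Notation expect := (expect P).
Local Notation mfun f := (measurable_fun setT (EFin \o f)).

Lemma expect_ge0 (f : Omega -> R) : (forall w, 0 <= f w) -> (0 <= expect f)%E.
Proof. by move=> f0; apply: integral_ge0 => w _; rewrite lee_fin. Qed.

Lemma le_expect (f g : Omega -> R) : mfun f -> mfun g -> (forall w, 0 <= f w) ->
  (forall w, f w <= g w) -> (expect f <= expect g)%E.
Proof.
move=> mf mg f0 fg; apply: ge0_le_integral => // w _; rewrite lee_fin//.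
Qed.

Lemma expectD (f g : Omega -> R) : mfun f -> mfun g -> (forall w, 0 <= f w) ->
  (forall w, 0 <= g w) -> (expect (fun w => f w + g w)%R = expect f + expect g)%E.
Proof.
move=> mf mg f0 g0; rewrite /expect -ge0_integralD// => w _; by rewrite lee_fin.
Qed.

Lemma expectZ (a : R) (f : Omega -> R) : mfun f -> 0 <= a -> (forall w, 0 <= f w) ->
  (expect (fun w => a * f w)%R = a%:E * expect f)%E.
Proof.
move=> mf a0 f0; rewrite /expect -ge0_integralZl_EFin// => w _; by rewrite lee_fin.
Qed.

Lemma expect_sum (I : Type) (r : seq I) (f : I -> Omega -> R) :
  (forall k, mfun (f k)) -> (forall k w, 0 <= f k w) ->
  (expect (fun w => \sum_(k <- r) f k w)%R = \sum_(k <- r) expect (f k))%E.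
Proof.
move=> mf f0; rewrite /expect -ge0_integral_sum//; last first.
  by move=> k w _; rewrite lee_fin.
by apply: eq_integral => w _; rewrite sumEFin.
Qed.

Lemma expect_cst (a : R) : expect (cst a) = a%:E.
Proof.
rewrite (_ : expect _ = \int[P]_w cst a%:E w)%E// integral_cst//.
by rewrite [X in (_ * X)%E](probability_setT P) mule1.
Qed.

Lemma expect_indicator (b : Omega -> bool) (f : Omega -> R) :
  (expect (fun w => (b w)%:R * f w)%R = \int[P]_(w in [set w | b w]) (f w)%:E)%E.
Proof.
rewrite [RHS]integral_mkcond; apply: eq_integral => w _; rewrite patchE.
case: ifPn => [/set_mem/= ->|]; first by rewrite mul1r.
by rewrite notin_setE/= => /negP/negbTE ->; rewrite mul0r.
Qed.

End expectation.

(** * Convergence of nonnegative supermartingales *)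

Section supermartingale.
Context {d : measure_display} {Omega : measurableType d} {R : realType}.
Variable P : probability Omega R.
Variables (A : countType) (Z : nat -> Omega -> A) (xi : nat -> Omega -> R).
Hypothesis mZ : forall n a, measurable (Z n @^-1` [set a]).
Hypothesis Z_filtration : forall n, determined_by (Z n.+1) (Z n).
Hypothesis xi_adapted : forall n, determined_by (Z n) (xi n).
Hypothesis xi_ge0 : forall n w, 0 <= xi n w.
(** The inequality [E[xi_(n+1) | Z_n] <= xi_n], tested against indicators of past events. *)
Hypothesis xi_super : forall n (c : Omega -> bool), determined_by (Z n) c ->
  (expect P (fun w => (c w)%:R * xi n.+1 w)%R <=
   expect P (fun w => (c w)%:R * xi n w)%R)%E.

Lemma filtration_le k n : (k <= n)%N -> determined_by (Z n) (Z k).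
Proof.
move=> kn; rewrite -(subnK kn); elim: (n - k)%N => [|p IH] w w'; first by rewrite add0n.
by rewrite addSn => /Z_filtration; exact: IH.
Qed.

Lemma adapted_le k n : (k <= n)%N -> determined_by (Z n) (xi k).
Proof. by move=> kn w w' /(filtration_le kn); exact: xi_adapted. Qed.

Lemma holding_adapted (a b : R) n :
  determined_by (Z n) (fun w => holding a b (xi ^~ w) n).
Proof.
by move=> w w' e; apply: holding_determined => k kn; exact: (adapted_le kn).
Qed.

Lemma sells_adapted (a b : R) k n : (k < n)%N ->
  determined_by (Z n) (fun w => sells a b (xi ^~ w) k).
Proof.
move=> kn w w' e; rewrite /sells (adapted_le kn e).
by rewrite (holding_adapted a b (filtration_le (ltnW kn) e)).
Qed.

(** After [trading_capitalS] only the held price still moves, and holding at time [n] is a past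
    event, so [xi_super] applies. The initial capital is at most [a]. *)
Lemma expect_trading_capital (a b : R) n : 0 <= a < b ->
  (expect P (fun w => trading_capital a b (xi ^~ w) n) <= a%:E)%E.
Proof.
move=> /andP[a0 ab]; have ba0 : 0 <= b - a by rewrite subr_ge0 ltW.
pose U n w : R := (b - a) * \sum_(0 <= k < n) (sells a b (xi ^~ w) k)%:R.
have U0 k w : 0 <= U k w by rewrite mulr_ge0// sumr_ge0.
pose hold k w := holding a b (xi ^~ w) k.
have U_adapted k : determined_by (Z k) (U k).
  move=> w w' e; congr (_ * _); apply: eq_big_nat => l /andP[_ lk].
  by rewrite (sells_adapted a b lk e).
have hold_adapted k : determined_by (Z k) (hold k) by exact: holding_adapted.
(* Isolates the one summand affected by the price at time [l]; the rest is determined at time [k]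
   and nonnegative. *)
have split k l w : U k w + (if hold k w then xi l w else a) =
   (U k w + (~~ hold k w)%:R * a) + (hold k w)%:R * xi l w.
  by rewrite -addrA; congr (_ + _); case: (hold k w); rewrite ?mul0r ?mul1r ?add0r ?addr0.
elim: n => [|n IH].
  rewrite -[leRHS](expect_cst P); apply: le_expect.
  - apply: (determined_measurable (mZ 0)) => w w' e.
    by rewrite /trading_capital !big_geq//= (xi_adapted e).
  - by apply/measurable_EFinP; exact: measurable_cst.
  - move=> w; rewrite /trading_capital big_geq// mulr0 add0r.
    by case: ifP.
  - by move=> w; rewrite /trading_capital big_geq// mulr0 add0r/=; case: ifP.
apply: le_trans IH.
have tc0 k w : 0 <= trading_capital a b (xi ^~ w) k.
  by rewrite /trading_capital addr_ge0//; [exact: U0|case: ifP].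
have step : (expect P (fun w => trading_capital a b (xi ^~ w) n.+1) <=
    expect P (fun w => U n w + (if hold n w then xi n.+1 w else a))%R)%E.
  apply: le_expect => //.
  - apply: (determined_measurable (mZ n.+1)) => w w' e.
    rewrite /trading_capital (holding_adapted a b e) (xi_adapted e).
    by congr (_ + _); exact: U_adapted.
  - apply: (determined_measurable (mZ n.+1)) => w w' e.
    rewrite (xi_adapted e); have {}e := Z_filtration e.
    by rewrite (U_adapted _ _ _ e) (hold_adapted _ _ _ e).
  - by move=> w; exact: trading_capitalS.
apply: le_trans step _.
rewrite (_ : (fun w => trading_capital a b (xi ^~ w) n) =
   (fun w => U n w + (if hold n w then xi n w else a)))//.
under [in X in (X <= _)%E]eq_fun do rewrite split.
under [in X in (_ <= X)%E]eq_fun do rewrite split.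
have m1 : measurable_fun setT (EFin \o (fun w => U n w + (~~ hold n w)%:R * a)).
  apply: (determined_measurable (mZ n)) => w w' e.
  by rewrite (U_adapted _ _ _ e) (hold_adapted _ _ _ e).
have n1 w : 0 <= U n w + (~~ hold n w)%:R * a.
  by rewrite addr_ge0// mulr_ge0.
have m2 : measurable_fun setT (EFin \o (fun w => (hold n w)%:R * xi n w)).
  apply: (determined_measurable (mZ n)) => w w' e.
  by rewrite (hold_adapted _ _ _ e) (xi_adapted e).
have m3 : measurable_fun setT (EFin \o (fun w => (hold n w)%:R * xi n.+1 w)).
  apply: (determined_measurable (mZ n.+1)) => w w' e.
  by rewrite (xi_adapted e) (hold_adapted _ _ _ (Z_filtration e)).
have n2 k w : 0 <= (hold n w)%:R * xi k w by rewrite mulr_ge0.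
rewrite (expectD P m1 m3)// (expectD P m1 m2)//.
by apply: leeD => //; exact: xi_super.
Qed.

(** The capital dominates [b - a] times the number of sales, whose expectation is therefore bounded.
    Terms valued in [0] and [b - a] that tend to [0] are eventually [0]. *)
Lemma ae_finitely_many_upcrossings (a b : R) : 0 <= a < b ->
  {ae P, forall w, \forall n \near \oo, ~~ sells a b (xi ^~ w) n}.
Proof.
move=> ab; have /andP[a0 ab'] := ab; have ba : 0 < b - a by rewrite subr_gt0.
pose f k w : R := (b - a) * (sells a b (xi ^~ w) k)%:R.
have f0 k w : 0 <= f k w by rewrite mulr_ge0// ltW.
have mf k : measurable_fun setT (EFin \o f k).
  apply: (determined_measurable (mZ k.+1)) => w w' e.
  by rewrite /f (sells_adapted a b (ltnSn k) e).
have hs n : (\sum_(0 <= k < n) expect P (f k) <= a%:E)%E.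
  rewrite -expect_sum//; apply: le_trans (expect_trading_capital n ab).
  apply: le_expect => //.
  - apply: (determined_measurable (mZ n)) => w w' e.
    by apply: eq_big_nat => l /andP[_ ln]; rewrite /f (sells_adapted a b ln e).
  - apply: (determined_measurable (mZ n)) => w w' e.
    rewrite /trading_capital (holding_adapted a b e) (xi_adapted e).
    congr (_ * _ + _); apply: eq_big_nat => l /andP[_ ln].
    by rewrite (sells_adapted a b ln e).
  - by move=> w; rewrite sumr_ge0.
  - move=> w; rewrite /f -mulr_sumr /trading_capital lerDl.
    by case: ifP.
have := ae_cvg0_of_summable mf f0 hs; apply: filterS => w.
have ba2 : 0 < (b - a) / 2 by rewrite divr_gt0.
move=> /cvgr0Pnorm_le/(_ _ ba2); apply: filterS => n; apply: contraLR.
rewrite negbK /f => ->; rewrite mulr1 gtr0_norm// -ltNge; lra.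
Qed.

(** Doob's theorem: bounded expectations exclude divergence to infinity, and finitely many
    upcrossings of each rational band exclude oscillation. *)
Lemma supermartingale_cvg (M : R) : (forall n, expect P (xi n) <= M%:E)%E ->
  {ae P, forall w, cvgn (xi ^~ w)}.
Proof.
move=> hM.
have mxi n : measurable_fun setT (EFin \o xi n).
  exact: (determined_measurable (mZ n)).
have bnd := ae_frequently_bounded mxi xi_ge0 hM.
(* Enumerating pairs of rationals by their codes leaves only countably many null sets to discard. *)
have upc : {ae P, forall w, forall n : nat, forall pq : rat * rat,
    choice.unpickle n = Some pq -> 0 <= pq.1 < pq.2 ->
    \forall n \near \oo, ~~ sells (ratr pq.1) (ratr pq.2) (xi ^~ w) n}.
  apply: ae_foralln => n; case e : (choice.unpickle n) => [pq|]; last exact: aeW.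
  have [pq0|npq] := boolP (0 <= pq.1 < pq.2); last first.
    by apply: aeW => w _ [<-]; rewrite (negbTE npq).
  have := @ae_finitely_many_upcrossings (ratr pq.1) (ratr pq.2).
  rewrite ler0q ltr_rat => /(_ pq0); apply: filterS => w h _ [<-] _.
  exact: h.
apply: filterS2 bnd upc => w bw uw.
apply: cvg_of_finitely_many_upcrossings => // p q pq.
by apply: (uw (choice.pickle (p, q)) (p, q)); rewrite ?choice.pickleK.
Qed.

End supermartingale.

Lemma mkseq_eqP (A : eqType) (f g : nat -> A) p :
  mkseq f p = mkseq g p <-> forall n, (n < p)%N -> f n = g n.
Proof.
rewrite /mkseq -eq_in_map; split=> h n; last by rewrite mem_iota add0n => /h.
by move=> np; apply: h; rewrite mem_iota.
Qed.

(** * Histories of blocks and delays, and their independence from the next draw *)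

Section histories.
Context {d : measure_display} {Omega : measurableType d} {R : realType}.
Variable P : probability Omega R.

Definition prefix_event (A : countType) (X : nat -> Omega -> A) (p : nat)
  (B : nat -> set A) : set Omega := [set w | forall n, (n < p)%N -> B n (X n w)].

Section one_sequence.
Variables (A : countType) (X : nat -> Omega -> A).

Lemma prefix_eventS p B :
  prefix_event X p.+1 B = X p @^-1` B p `&` prefix_event X p B.
Proof.
apply/seteqP; split=> [w h|w [hp h] n]; first by split=> [|n np]; apply: h => //; exact: ltnW.
by rewrite ltnS leq_eqVlt => /predU1P[->//|]; exact: h.
Qed.

Lemma prefix_event0 B : prefix_event X 0 B = setT.
Proof. by apply/seteqP; split=> // w _ n; rewrite ltn0. Qed.

Lemma eq_prefix_event p B C : (forall n, (n < p)%N -> B n = C n) ->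
  prefix_event X p B = prefix_event X p C.
Proof.
by move=> BC; apply/seteqP; split=> w h n np; have := h n np; rewrite BC.
Qed.

Lemma prefix_event_sigma p B : sigma_of X (prefix_event X p B).
Proof.
have : sigma_algebra setT (sigma_of X) by exact: smallest_sigma_algebra.
move=> /(sigma_algebraP (fun _ _ => @subsetT _ _))[sT _ _ sI].
elim: p => [|p IH]; first by rewrite prefix_event0.
by rewrite prefix_eventS; apply: sI => //; apply: sub_gen_smallest; exists p, (B p).
Qed.

Lemma measurable_prefix_event p B : random_sequence X -> measurable (prefix_event X p B).
Proof.
move=> mX; elim: p => [|p IH]; first by rewrite prefix_event0.
by rewrite prefix_eventS; exact: measurableI.
Qed.

Lemma prob_prefix_event p B : mutually_independent P X ->
  P (prefix_event X p B) = (\prod_(0 <= n < p) P (X n @^-1` B n))%E.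
Proof.
move=> iX; have := iX [fset n | n in iota 0 p]%fset B.
rewrite (_ : \bigcap_(_ in _) _ = prefix_event X p B); last first.
  apply/seteqP; split=> w h n; have := h n; rewrite /= !inE mem_iota add0n/=.
    by move=> + np; apply.
  by [].
move=> ->; rewrite /index_iota subn0; apply: perm_big.
by apply: uniq_perm => [||n]; rewrite ?fset_uniq ?iota_uniq// !inE.
Qed.

Lemma prob_prefix_eventS p B : mutually_independent P X ->
  P (prefix_event X p.+1 B) = (P (X p @^-1` B p) * P (prefix_event X p B))%E.
Proof. by move=> iX; rewrite !prob_prefix_event// big_nat_recr//= muleC. Qed.

End one_sequence.

Variables (A1 A2 : countType) (i : nat -> Omega -> A1) (j : nat -> Omega -> A2).

(** Two lengths, because each step is averaged in two stages: [history k k] is the past, and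
    [history k k.+1] also reveals the delay of step [k] but not its block. *)
Definition history (p q : nat) (w : Omega) : seq A1 * seq A2 :=
  (mkseq (i ^~ w) p, mkseq (j ^~ w) q).

Lemma historyP p q w w' : history p q w = history p q w' <->
  (forall n, (n < p)%N -> i n w = i n w') /\ (forall n, (n < q)%N -> j n w = j n w').
Proof.
by rewrite -!mkseq_eqP; split=> [[-> ->]|[h1 h2]]//; congr pair.
Qed.

Lemma history_atom p q w : [set w' | history p q w' = history p q w] =
  prefix_event i p (fun n => [set i n w]) `&` prefix_event j q (fun n => [set j n w]).
Proof. by apply/seteqP; split=> w' /historyP. Qed.

Lemma history_determined p q p' q' : (p <= p')%N -> (q <= q')%N ->
  determined_by (history p' q') (history p q).
Proof.
move=> pp qq w w' /historyP[h1 h2]; apply/historyP; split=> n np.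
  exact/h1/(leq_trans np).
exact/h2/(leq_trans np).
Qed.

Hypothesis ri : random_sequence i.
Hypothesis rj : random_sequence j.

Lemma measurable_history p q a : measurable (history p q @^-1` [set a]).
Proof.
have [[w ha]|na] := pselect (exists w, history p q w = a); last first.
  rewrite (_ : _ @^-1` _ = set0)//; apply/seteqP; split=> // w ha.
  by apply: na; exists w.
rewrite -ha -[_ @^-1` _]/[set w' | history p q w' = history p q w] history_atom.
by apply: measurableI; exact: measurable_prefix_event.
Qed.

Hypothesis mi : mutually_independent P i.
Hypothesis mj : mutually_independent P j.
Hypothesis ij : independent_sequences P i j.

(** The condition on [i p] lengthens the block cylinder by one coordinate; independence of the two
    sequences splits off the delay cylinder, and the product formula splits off the new
    coordinate. *)
Lemma history_indep_fst p q (S : set A1) w :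
  (P (i p @^-1` S `&` [set w' | history p q w' = history p q w]) =
   P (i p @^-1` S) * P [set w' | history p q w' = history p q w])%E.
Proof.
pose B n := if n == p then S else [set i n w].
have BE : prefix_event i p B = prefix_event i p (fun n => [set i n w]).
  by apply: eq_prefix_event => n np; rewrite /B ltn_eqF.
have Bp : B p = S by rewrite /B eqxx.
rewrite history_atom setIA -BE -{1}Bp -prefix_eventS.
rewrite ij; try exact: prefix_event_sigma.
rewrite ij; try exact: prefix_event_sigma.
by rewrite prob_prefix_eventS// Bp muleA.
Qed.

Lemma history_indep_snd p q (S : set A2) w :
  (P (j q @^-1` S `&` [set w' | history p q w' = history p q w]) =
   P (j q @^-1` S) * P [set w' | history p q w' = history p q w])%E.
Proof.
pose B n := if n == q then S else [set j n w].
have BE : prefix_event j q B = prefix_event j q (fun n => [set j n w]).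
  by apply: eq_prefix_event => n np; rewrite /B ltn_eqF.
have Bq : B q = S by rewrite /B eqxx.
rewrite history_atom setICA -BE -{1}Bq -prefix_eventS.
rewrite ij; try exact: prefix_event_sigma.
rewrite ij; try exact: prefix_event_sigma.
by rewrite prob_prefix_eventS// Bq muleCA.
Qed.

End histories.

(** * Sums and convolutions *)

Section sums_from_one.
Context {R : realType}.
Implicit Types u v : nat -> R.

Lemma nondecreasing_sum_from1 u : (forall l, (1 <= l)%N -> 0 <= u l) ->
  nondecreasing_seq (fun n => \sum_(1 <= l < n) u l).
Proof.
move=> u0; apply/nondecreasing_seqP => -[|n]; first by rewrite !big_geq.
by rewrite [leRHS]big_nat_recr//= lerDl u0.
Qed.

Lemma sum_le_sum_from1 u n : (forall l, (1 <= l)%N -> 0 <= u l) ->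
  summable_from1 u -> \sum_(1 <= l < n) u l <= sum_from1 u.
Proof.
by move=> u0 su; apply: (nondecreasing_cvgn_le (nondecreasing_sum_from1 u0) su).
Qed.

Lemma sum_from1_le u M : summable_from1 u ->
  (forall n, \sum_(1 <= l < n) u l <= M) -> sum_from1 u <= M.
Proof. by move=> su h; apply: limr_le => //; near=> n; exact: h.
Unshelve. all: by end_near. Qed.

Lemma summable_from1_le u v : (forall l, (1 <= l)%N -> 0 <= u l <= v l) ->
  summable_from1 v -> summable_from1 u.
Proof.
move=> uv sv; have u0 l : (1 <= l)%N -> 0 <= u l by move=> /uv/andP[].
have v0 l : (1 <= l)%N -> 0 <= v l by move=> /uv/andP[/le_trans]; apply.
apply: nondecreasing_is_cvgn; first exact: nondecreasing_sum_from1.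
exists (sum_from1 v) => _ [n _ <-]; apply: le_trans (sum_le_sum_from1 n v0 sv).
by apply: ler_sum_nat => l /andP[/uv/andP[]].
Qed.

Definition tail_from u l : R := sum_from1 u - \sum_(1 <= k < l) u k.

Lemma tail_from_ge0 u l : (forall l, (1 <= l)%N -> 0 <= u l) ->
  summable_from1 u -> 0 <= tail_from u l.
Proof. by move=> u0 su; rewrite subr_ge0 sum_le_sum_from1. Qed.

Lemma tail_from1 u : tail_from u 1 = sum_from1 u.
Proof. by rewrite /tail_from big_geq// subr0. Qed.

Lemma tail_fromS u l : (1 <= l)%N -> tail_from u l = tail_from u l.+1 + u l.
Proof. by move=> l1; rewrite /tail_from big_nat_recr//= opprD addrA subrK. Qed.

(** Abel summation leaves the remainder [n * tail_from u n.+1], which is at most the sum of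
    [k * u k] over [k > n]. This makes the Lyapunov weights summable. *)
Lemma sum_tail_from u n : (forall l, (1 <= l)%N -> 0 <= u l) ->
  summable_from1 u -> summable_from1 (fun l => u l * l%:R) ->
  \sum_(1 <= l < n) tail_from u l <= sum_from1 (fun l => u l * l%:R).
Proof.
move=> u0 su su1; set L := sum_from1 _.
have ul0 l : (1 <= l)%N -> 0 <= u l * l%:R by move=> l1; rewrite mulr_ge0// u0.
have L0 : 0 <= L by have := sum_le_sum_from1 0 ul0 su1; rewrite big_geq.
case: n => [|n]; first by rewrite big_geq.
have -> : \sum_(1 <= l < n.+1) tail_from u l =
    \sum_(1 <= l < n.+1) u l * l%:R + n%:R * tail_from u n.+1.
  elim: n => [|n IH]; first by rewrite !big_geq// mul0r addr0.
  by rewrite [LHS]big_nat_recr//= [in RHS]big_nat_recr//= IH tail_fromS// -natr1; ring.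
rewrite addrC -lerBrDr.
have [->|n0] := posnP n; first by rewrite mul0r subr_ge0 sum_le_sum_from1.
rewrite mulrC -ler_pdivlMr ?ltr0n// /tail_from lerBlDr.
apply: sum_from1_le => // N.
have [Nn|nN] := leqP N n.+1.
  apply: (@le_trans _ _ (\sum_(1 <= k < n.+1) u k)).
    exact: (nondecreasing_sum_from1 u0).
  by rewrite lerDr divr_ge0// subr_ge0 sum_le_sum_from1.
rewrite (big_cat_nat _ (n := n.+1))//=; last exact: ltnW.
rewrite addrC lerD2r ler_pdivlMr ?ltr0n// lerBrDr.
apply: le_trans (sum_le_sum_from1 N ul0 su1).
rewrite [leRHS](big_cat_nat _ (n := n.+1))//=; last exact: ltnW.
rewrite [leRHS]addrC lerD2r mulr_suml; apply: ler_sum_nat => l /andP[nl _].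
by rewrite ler_wpM2l ?ler_nat ?(ltnW nl)// u0// (leq_trans _ nl).
Qed.

(** Cut the sum where the tail of [u] becomes small: before the cut [k - l] is large and [v] small,
    after it [v] is bounded and [u] has little mass. *)
Lemma convolution_cvg0 u v (L : R) : (forall l, (1 <= l)%N -> 0 <= u l) ->
  (forall n, \sum_(1 <= l < n) u l <= L) -> (forall n, 0 <= v n) ->
  v @ \oo --> 0 -> \sum_(1 <= l < k.+1) u l * v (k - l)%N @[k --> \oo] --> 0.
Proof.
move=> u0 uL v0 v_to0.
have [M M0 vM] : exists2 M, 0 <= M & forall n, v n <= M.
  have /cvg_seq_bounded/pinfty_ex_gt0[M M0 hM] : cvgn v by apply/cvg_ex; exists 0.
  by exists M => [|n]; [exact: ltW|rewrite -[v n]ger0_norm//; exact: hM].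
have L0 : 0 <= L by have := uL 0%N; rewrite big_geq.
have su : summable_from1 u.
  apply: nondecreasing_is_cvgn; first exact: nondecreasing_sum_from1.
  by exists L => _ [n _ <-].
apply/cvgr0Pnorm_le => e e0.
have M1 : 0 < M + 1 by rewrite ltr_wpDl.
have L1 : 0 < L + 1 by rewrite ltr_wpDl.
have [N1 [N10 hN1]] : exists N1, (1 <= N1)%N /\ tail_from u N1 <= e / 2 / (M + 1).
  have e' : 0 < e / 2 / (M + 1) by rewrite !divr_gt0.
  have := su => /cvgrPdist_le/(_ _ e')/(filterI (nbhs_infty_ge 1)).
  move=> /filter_ex[N [/= N1 hN]]; exists N; split => //.
  by apply: le_trans hN; rewrite ler_norm.
have e'' : 0 < e / 2 / (L + 1) by rewrite !divr_gt0.
move/cvgr0Pnorm_le : v_to0 => /(_ _ e'')[N2 _ hN2].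
exists (N1 + N2)%N => // k /= Nk.
rewrite ger0_norm; last first.
  by rewrite big_nat_cond sumr_ge0// => l /andP[/andP[l1 _] _]; rewrite mulr_ge0// u0.
have N1k : (N1 <= k.+1)%N by rewrite ltnW// ltnS (leq_trans _ Nk)// leq_addr.
rewrite (big_cat_nat _ (n := N1))//= [leRHS](splitr e); apply: lerD.
  apply: (@le_trans _ _ (\sum_(1 <= l < N1) u l * (e / 2 / (L + 1)))).
    apply: ler_sum_nat => l /andP[l1 lN]; rewrite ler_wpM2l ?u0//.
    apply: le_trans (ler_norm _) _; apply: hN2 => /=.
    by rewrite leq_subRL; [rewrite (leq_trans _ Nk)// leq_add2r ltnW|
       rewrite (leq_trans (ltnW lN))// (leq_trans _ Nk)// leq_addr].
  rewrite -mulr_suml mulrA ler_pdivrMr// mulrC ler_wpM2l ?ltW ?divr_gt0//.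
  by rewrite (le_lt_trans (uL _))// ltrDl.
apply: (@le_trans _ _ (\sum_(N1 <= l < k.+1) u l * M)).
  by apply: ler_sum_nat => l /andP[l1 lN]; rewrite ler_wpM2l ?u0// (leq_trans N10).
rewrite -mulr_suml; apply: (@le_trans _ _ (tail_from u N1 * (M + 1))).
  apply: ler_pM => //; rewrite ?lerDl//.
    by rewrite big_nat_cond sumr_ge0// => l /andP[/andP[l1 _] _]; rewrite u0// (leq_trans N10).
  rewrite lerBrDr addrC -big_cat_nat//=; exact: sum_le_sum_from1.
by rewrite -ler_pdivlMr.
Qed.

End sums_from_one.

(** * The ARock iteration *)

Section arock_descent.
Context {R : realType} {H : completeNormedModType R} (ip : {dot H for idfun}).
Context {m : nat} {V : 'I_m -> set H} {pr : 'I_m -> H -> H}.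
Hypothesis hip : inner_product ip.
Hypothesis hdec : orthogonal_decomposition ip V pr.

(** If [n > k], truncated subtraction makes the left side [f k - f 0], and every [l <= k] satisfies
    [l <= n]. A range free of [n] lets blocks with different delays be summed together. *)
Lemma telescope_delay (f : nat -> H) k n :
  f k - f (k - n)%N = \sum_(1 <= l < k.+1 | (l <= n)%N) (f (k - l).+1 - f (k - l)%N).
Proof.
have tel p : (p <= k)%N ->
    \sum_(1 <= l < p.+1) (f (k - l).+1 - f (k - l)%N) = f k - f (k - p)%N.
  elim: p => [_|p IH pk]; first by rewrite big_geq// subn0 subrr.
  rewrite big_nat_recr//= IH; last exact: ltnW.
  by rewrite -subSn// subSS addrA subrK.
have [nk|kn] := leqP n k.
  rewrite -tel//.
  rewrite (@big_nat_widen _ _ _ 1%N n.+1 k.+1)//.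
have -> : (k - n = k - k)%N by rewrite subnn; apply/eqP; rewrite subn_eq0 ltnW.
rewrite -tel// [in RHS]big_nat_cond [LHS]big_nat_cond; apply: eq_bigl => l.
by case: (ltnP l k.+1) => lk; rewrite ?andbF//= (leq_trans _ (ltnW kn)).
Qed.

Lemma delayed_iterateB (X : nat -> H) k (v : {ffun 'I_m -> nat}) :
  X k - delayed_iterate pr X k v =
  \sum_(1 <= l < k.+1)
    \sum_(b | (l <= v b)%N) pr b (X (k - l).+1 - X (k - l)%N).
Proof.
rewrite -{1}(pr_sum hdec (X k)) -sumrB.
under eq_bigr do rewrite (telescope_delay (fun n => pr _ (X n))).
rewrite (exchange_big_dep predT)//=; apply: eq_bigr => l _.
by apply: eq_bigr => b _; rewrite (prB hip hdec).
Qed.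

Lemma norm_delayed_terms (X : nat -> H) k l (v : {ffun 'I_m -> nat}) :
  `|\sum_(b | (l <= v b)%N) pr b (X (k - l).+1 - X (k - l)%N)| ^+ 2 <=
  `|X (k - l).+1 - X (k - l)%N| ^+ 2 *+ (l <= current_delay v)%N.
Proof.
case: (leqP l (current_delay v)) => lv.
  rewrite (sqr_norm_sum_pr hip hdec) mulr1n -(sqr_norm_pr hip hdec).
  by rewrite [leRHS](bigID (fun b => l <= v b)%N)/= lerDl sumr_ge0// => b _; exact: sqr_ge0.
rewrite big1 ?normr0 ?expr0n// => b lb; move: lv; rewrite ltnNge.
by rewrite (leq_trans lb)// /current_delay leq_bigmax.
Qed.

(** The sum over [b] is [m] times the average over a uniform block. Splitting [X k - z] at the
    delayed iterate, cocoercivity yields [- eta * |s|^2] and Young's inequality bounds the rest. *)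
Lemma block_step_descent (T : H -> H) (X : nat -> H) k (v : {ffun 'I_m -> nat}) z
    (eta E : R) (eps : nat -> R) (s : H) :
  nonexpansive T -> T z = z -> 0 < eta ->
  (forall l, (1 <= l)%N -> 0 < eps l) ->
  \sum_(1 <= l < k.+1) (eps l)^-1 <= E ->
  s = delayed_iterate pr X k v - T (delayed_iterate pr X k v) ->
  \sum_b `|X k - eta *: pr b s - z| ^+ 2 + eta * (1 - eta * (1 + E)) * `|s| ^+ 2
  <= m%:R * `|X k - z| ^+ 2 +
     \sum_(1 <= l < k.+1)
       eps l * `|X (k - l).+1 - X (k - l)%N| ^+ 2 *+ (l <= current_delay v)%N.
Proof.
move=> nT Tz eta0 eps0 sE sdef.
have -> : \sum_b `|X k - eta *: pr b s - z| ^+ 2 =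
    m%:R * `|X k - z| ^+ 2 - 2 * eta * ip s (X k - z) + eta ^+ 2 * `|s| ^+ 2.
  under eq_bigr => b _.
    rewrite addrAC (sqr_normB hip) (ipZr ip) normrZ exprMn gtr0_norm//.
    rewrite (_ : 2 * _ = 2 * eta * ip (X k - z) (pr b s)); last by rewrite mulrA.
    over.
  rewrite big_split sumrB/= sumr_const card_ord -!mulr_sumr (sqr_norm_pr hip hdec).
  have -> : \sum_b ip (X k - z) (pr b s) = ip (X k - z) s.
    by rewrite -[in RHS](pr_sum hdec s) linear_sumr.
  by rewrite (ipC ip s) -[X in X - _]mulr_natl.
have coco := nonexpansive_cocoercive hip (delayed_iterate pr X k v) nT Tz.
have -> : X k - z = (delayed_iterate pr X k v - z) +
                    (X k - delayed_iterate pr X k v).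
  by rewrite [RHS]addrC addrA subrK.
rewrite -sdef in coco; clear sdef.
set xh := delayed_iterate pr X k v in coco *.
(* At lag [l], Young's inequality with weight [eps l] is applied to [- (eta *: s)] and the lagged
   increment; the factors [(eps l)^-1] add up to at most [E]. *)
have bnd : - (2 * eta * ip s (X k - xh)) <= eta ^+ 2 * E * `|s| ^+ 2 +
     \sum_(1 <= l < k.+1)
       eps l * `|X (k - l).+1 - X (k - l)%N| ^+ 2 *+ (l <= current_delay v)%N.
  rewrite delayed_iterateB linear_sumr/= mulr_sumr -sumrN.
  apply: (@le_trans _ _ (\sum_(1 <= l < k.+1) (eta ^+ 2 * (eps l)^-1 * `|s| ^+ 2 +
      eps l * `|X (k - l).+1 - X (k - l)%N| ^+ 2 *+ (l <= current_delay v)%N))).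
    apply: ler_sum_nat => l /andP[l1 lk].
    set D := \sum_(b | _) _.
    have := ip_bound hip (- (eta *: s)) D (eps0 l l1).
    rewrite linearNl/= (ipZl ip) normrN normrZ exprMn gtr0_norm//.
    have := norm_delayed_terms X k l v; rewrite -/D => hD.
    have : eps l * `|D| ^+ 2 <=
        eps l * `|X (k - l).+1 - X (k - l)%N| ^+ 2 *+ (l <= current_delay v)%N.
      by rewrite -mulrnAr ler_wpM2l// ltW// eps0.
    move=> h1 h2.
    have -> : - (2 * eta * ip s D) = 2 * - (eta * ip s D) by ring.
    have -> : eta ^+ 2 * (eps l)^-1 * `|s| ^+ 2 = (eps l)^-1 * (eta ^+ 2 * `|s| ^+ 2) by ring.
    lra.
  rewrite big_split/= lerD2r -mulr_suml -mulr_sumr.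
  by rewrite ler_wpM2r ?sqr_ge0// ler_wpM2l ?sqr_ge0.
rewrite linearDr/=.
have := ler_wpM2l (ltW eta0) coco.
lra.
Qed.

End arock_descent.

Lemma cvg0_of_scaled_sqr (R : realType) (U : normedModType R) (u : nat -> U) (b : R) :
  0 < b -> b * `|u n| ^+ 2 @[n --> \oo] --> 0 -> u @ \oo --> 0.
Proof.
move=> b0 h; apply/cvgr0Pnorm_le => e e0.
have be : 0 < b * e ^+ 2 by rewrite mulr_gt0// exprn_gt0.
move/cvgr0Pnorm_le : h => /(_ _ be); apply: filterS => n.
rewrite ger0_norm ?mulr_ge0 ?sqr_ge0 ?(ltW b0)//.
by rewrite ler_pM2l// ler_sqr// nnegrE ?(ltW e0).
Qed.

(** Here [r] is [1/m], [N] is [m] and [e] the step size. The net coefficient of [S] is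
    [r * e * (1 - e * (1 + r * C + E))], that is [r * e * (1 - c)]: this explains the formula for
    the step. *)
Lemma descent_algebra (R : realFieldType) (r N A C e S D X B E c : R) :
  r * N = 1 -> 0 <= r -> e * (1 + r * C + E) = c ->
  A + e * (1 - e * (1 + E)) * S <= N * X + B ->
  r * (A + r * (C * (e ^+ 2 * S) + N * D)) + r * (e * (1 - c)) * S <=
  X + r * D + r * B.
Proof.
move=> rN r0 <- /(ler_wpM2l r0) h.
have -> : r * (A + r * (C * (e ^+ 2 * S) + N * D)) =
  r * A + r * r * C * e ^+ 2 * S + r * N * (r * D) by ring.
have hX : r * (N * X + B) = r * N * X + r * B by ring.
by rewrite hX in h; rewrite rN mul1r in h *; lra.
Qed.

(** * Almost sure convergence of the ARock iterates *)

Section arock_convergence.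
Context {R : realType} {H : completeNormedModType R} (ip : {dot H for idfun}).
Context {m : nat} {V : 'I_m -> set H} {pr : 'I_m -> H -> H} {T : H -> H}.
Context {d : measure_display} {Omega : measurableType d}.
Variable P : probability Omega R.
Context {i : nat -> Omega -> 'I_m} {j : nat -> Omega -> {ffun 'I_m -> nat}}.
Variables (eps : nat -> R) (c : R) (x0 : H) (x : nat -> Omega -> H).

Local Notation pl := (delay_tail P j).
Local Notation a := (fun l => eps l * pl l).
Local Notation et := (c * step_bound m eps pl).

Hypothesis hip : inner_product ip.
Hypothesis hdec : orthogonal_decomposition ip V pr.
Hypothesis hT : nonexpansive T.
Hypothesis hi_iid : iid P i.
Hypothesis hi_unif : forall (k : nat) (b : 'I_m), P (i k @^-1` [set b]) = (m%:R^-1)%:E.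
Hypothesis hj_iid : iid P j.
Hypothesis hij : independent_sequences P i j.
Hypothesis heps : forall l : nat, (1 <= l)%N -> 0 < eps l.
Hypothesis heps_inv : summable_from1 (fun l => (eps l)^-1).
Hypothesis heps_tail : summable_from1 (fun l => eps l * pl l * l%:R).
Hypothesis hc : 0 < c < 1.
Hypothesis hx : forall w, arock pr T (fun=> et) (i ^~ w) (j ^~ w) x0 (x ^~ w).

Let ri : random_sequence i. Proof. by case: hi_iid. Qed.
Let rj : random_sequence j. Proof. by case: hj_iid. Qed.
Let mi : mutually_independent P i. Proof. by case: hi_iid. Qed.
Let mj : mutually_independent P j. Proof. by case: hj_iid. Qed.

Local Notation hist := (history i j).
Local Notation mfun f := (measurable_fun setT (EFin \o f)).

Let mhist p q (f : Omega -> R) : determined_by (hist p q) f -> mfun f.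
Proof. by move=> fZ; apply: determined_measurable fZ => b; exact: measurable_history. Qed.

Lemma m_gt0 : (0 < m)%N.
Proof. exact: leq_ltn_trans (leq0n _) (ltn_ord (i 0%N point)). Qed.

Lemma delay_tail_ge0 l : 0 <= pl l.
Proof. by rewrite /delay_tail fine_ge0. Qed.

Lemma prob_delay_ge k l : P [set w | (l <= current_delay (j k w))%N] = (pl l)%:E.
Proof.
have mS n : measurable [set w | (l <= current_delay (j n w))%N].
  exact: (rj n [set v | (l <= current_delay v)%N]).
rewrite /delay_tail fineK ?fin_num_measure//.
by case: hj_iid => _ _ /(_ k 0%N [set v | (l <= current_delay v)%N]).
Qed.

Let a_ge0 l : (1 <= l)%N -> 0 <= a l.
Proof. by move=> l1; rewrite mulr_ge0 ?delay_tail_ge0// ltW// heps. Qed.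

Let sa : summable_from1 a.
Proof.
apply: summable_from1_le heps_tail => l l1.
by rewrite a_ge0//= ler_peMr ?a_ge0// ler1n.
Qed.

Local Notation C := (sum_from1 a).
Local Notation E := (sum_from1 (fun l => (eps l)^-1)).

Let eps_inv_ge0 l : (1 <= l)%N -> 0 <= (eps l)^-1.
Proof. by move=> l1; rewrite invr_ge0 ltW// heps. Qed.

Let C_ge0 : 0 <= C.
Proof. by have := sum_le_sum_from1 0 a_ge0 sa; rewrite big_geq. Qed.

Let E_ge0 : 0 <= E.
Proof. by have := sum_le_sum_from1 0 eps_inv_ge0 heps_inv; rewrite big_geq. Qed.

Let m_inv_gt0 : 0 < m%:R^-1 :> R.
Proof. by rewrite invr_gt0 ltr0n m_gt0. Qed.

Let denom_gt0 : 0 < 1 + m%:R^-1 * C + E.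
Proof. by rewrite -addrA ltr_wpDr// addr_ge0// mulr_ge0// ltW. Qed.

Let et_gt0 : 0 < et.
Proof. by case/andP: hc => c0 _; rewrite mulr_gt0// invr_gt0. Qed.

Let etE : et * (1 + m%:R^-1 * C + E) = c.
Proof. by rewrite /step_bound divfK// gt_eqF. Qed.

(** The delay vector is an argument, so that the actual delay [j k w] and a frozen delay can both be
    inserted. *)
Definition residual k (v : {ffun 'I_m -> nat}) w : H :=
  delayed_iterate pr (x ^~ w) k v - T (delayed_iterate pr (x ^~ w) k v).

Definition sqr_step n w : R := `|x n.+1 w - x n w| ^+ 2.

Lemma arock_next k w :
  x k.+1 w = x k w - et *: pr (i k w) (residual k (j k w) w).
Proof.
have [_ h] := hx w; rewrite -[LHS](pr_sum hdec) -[x k w in RHS](pr_sum hdec).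
rewrite [in RHS](bigD1 (i k w))//= addrAC (bigD1 (i k w))//= h eqxx; congr (_ + _).
by apply: eq_bigr => b bi; rewrite h (negbTE bi).
Qed.

Lemma sqr_stepE k w :
  sqr_step k w = et ^+ 2 * `|pr (i k w) (residual k (j k w) w)| ^+ 2.
Proof.
by rewrite /sqr_step arock_next addrAC subrr sub0r normrN normrZ gtr0_norm// exprMn.
Qed.

Lemma residual_eq k v w w' : (forall n, (n <= k)%N -> x n w = x n w') ->
  residual k v w = residual k v w'.
Proof.
move=> xw; rewrite /residual.
have -> : delayed_iterate pr (x ^~ w) k v = delayed_iterate pr (x ^~ w') k v.
  by apply: eq_bigr => b _; rewrite xw// leq_subr.
by [].
Qed.

Lemma iterates_determined k w w' : hist k k w = hist k k w' ->
  forall n, (n <= k)%N -> x n w = x n w'.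
Proof.
elim: k => [_ n|k IH e n].
  by rewrite leqn0 => /eqP ->; have [-> _] := hx w; have [-> _] := hx w'.
have /IH{}IH : hist k k w = hist k k w' by exact: history_determined e.
rewrite leq_eqVlt => /predU1P[->|]; last by rewrite ltnS; exact: IH.
have /historyP[ei ej] := e.
by rewrite !arock_next ei// ej// (IH k)// (residual_eq _ IH).
Qed.

Lemma sqr_step_eq k l w w' : (forall n, (n <= k)%N -> x n w = x n w') ->
  (0 < l <= k)%N -> sqr_step (k - l) w = sqr_step (k - l) w'.
Proof.
move=> xw /andP[l0 lk]; rewrite /sqr_step !xw ?leq_subr//.
by rewrite ltn_subrL l0 (leq_trans l0 lk).
Qed.

(** Increments before time zero vanish, so the series of lagged terms stops at [l = k]. *)
Definition lyapunov z k w : R := `|x k w - z| ^+ 2 +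
  m%:R^-1 * \sum_(1 <= l < k.+1) tail_from a l * sqr_step (k - l) w.

(* The value of lyapunov z k.+1 when block b is updated at step k. *)
Definition lyapunov_next z k b w : R :=
  `|x k w - et *: pr b (residual k (j k w) w) - z| ^+ 2 +
  m%:R^-1 * (C * (et ^+ 2 * `|pr b (residual k (j k w) w)| ^+ 2) +
    \sum_(1 <= l < k.+1) tail_from a l.+1 * sqr_step (k - l) w).

(** All lags grow by one: the newest increment enters with weight [tail_from a 1 = C], and each
    older weight moves from [l] to [l.+1]. *)
Lemma lyapunovS z k w : lyapunov z k.+1 w = lyapunov_next z k (i k w) w.
Proof.
rewrite /lyapunov /lyapunov_next -sqr_stepE -arock_next; congr (_ + _ * _).
rewrite big_ltn// tail_from1 subSS subn0; congr (_ + _).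
by rewrite big_add1 /=; apply: eq_big_nat => l _; rewrite subSS.
Qed.

Let sum_tail_ge0 e k w :
  0 <= \sum_(1 <= l < k.+1) tail_from a (l + e) * sqr_step (k - l) w.
Proof. by apply: sumr_ge0 => l _; rewrite mulr_ge0 ?tail_from_ge0 ?sqr_ge0. Qed.

Lemma lyapunov_ge0 z k w : 0 <= lyapunov z k w.
Proof.
rewrite addr_ge0 ?sqr_ge0// mulr_ge0 ?(ltW m_inv_gt0)//.
by have := sum_tail_ge0 0 k w; under eq_bigr do rewrite addn0.
Qed.

Lemma lyapunov_next_ge0 z k b w : 0 <= lyapunov_next z k b w.
Proof.
rewrite addr_ge0 ?sqr_ge0// mulr_ge0 ?(ltW m_inv_gt0)// addr_ge0//.
  by apply: mulr_ge0; [exact: C_ge0|rewrite mulr_ge0 ?sqr_ge0].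
by have := sum_tail_ge0 1 k w; under eq_bigr do rewrite addn1.
Qed.

Lemma lyapunov_determined z k : determined_by (hist k k) (lyapunov z k).
Proof.
move=> w w' /iterates_determined xw; rewrite /lyapunov xw//; congr (_ + _ * _).
by apply: eq_big_nat => l lk; rewrite (sqr_step_eq xw).
Qed.

Let iterates_determinedS k w w' : hist k k.+1 w = hist k k.+1 w' ->
  (forall n, (n <= k)%N -> x n w = x n w') /\ j k w = j k w'.
Proof.
move=> e; split; last by have /historyP[_ ->] := e.
exact/iterates_determined/(history_determined (leqnn k) (leqnSn k)).
Qed.

Lemma lyapunov_next_determined z k b :
  determined_by (hist k k.+1) (lyapunov_next z k b).
Proof.
move=> w w' /iterates_determinedS[xw jw]; rewrite /lyapunov_next jw xw//.
rewrite (residual_eq _ xw); congr (_ + _ * (_ + _)).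
by apply: eq_big_nat => l lk; rewrite (sqr_step_eq xw).
Qed.

Local Notation gam := (m%:R^-1 * (et * (1 - c))).

Let gam_gt0 : 0 < gam.
Proof. by case/andP: hc => _ c1; rewrite mulr_gt0// mulr_gt0// subr_gt0. Qed.

(** Averaging over blocks turns the squared block steps into [|residual|^2] by Pythagoras, which the
    descent term absorbs. The delay indicator is left to be averaged later. *)
Lemma lyapunov_next_descent z k w : Fix T z ->
  m%:R^-1 * \sum_b lyapunov_next z k b w + gam * `|residual k (j k w) w| ^+ 2 <=
  `|x k w - z| ^+ 2
   + m%:R^-1 * \sum_(1 <= l < k.+1) tail_from a l.+1 * sqr_step (k - l) w
   + m%:R^-1 * \sum_(1 <= l < k.+1)
       eps l * sqr_step (k - l) w *+ (l <= current_delay (j k w))%N.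
Proof.
move=> Fz; set s := residual k (j k w) w.
have sE : \sum_(1 <= l < k.+1) (eps l)^-1 <= E.
  exact: (sum_le_sum_from1 k.+1 eps_inv_ge0 heps_inv).
have := @block_step_descent _ _ _ _ _ _ hip hdec T (x ^~ w) k (j k w) z et E eps s
  hT Fz et_gt0 heps sE erefl.
set B := \sum_(1 <= l < k.+1) _ *+ _; set A := \sum_b _ => h.
set D := \sum_(1 <= l < k.+1) tail_from a l.+1 * _.
rewrite /lyapunov_next -/s -/D big_split/= -/A.
rewrite -mulr_sumr big_split/= sumr_const card_ord -mulr_sumr -mulr_sumr.
rewrite (sqr_norm_pr hip hdec) -(mulr_natl D).
apply: descent_algebra h; [|exact: ltW|exact: etE].
by rewrite mulVf// gt_eqF// ltr0n m_gt0.
Qed.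

(** First average over the block, independent of [hist k k.+1], then apply the pathwise descent,
    then average over the delay, independent of [hist k k]. *)
Lemma expected_descent z k (ch : Omega -> bool) : Fix T z ->
  determined_by (hist k k) ch ->
  (expect P (fun w => (ch w)%:R * lyapunov z k.+1 w)%R +
   expect P (fun w => (ch w)%:R * (gam * `|residual k (j k w) w| ^+ 2))%R <=
   expect P (fun w => (ch w)%:R * lyapunov z k w)%R)%E.
Proof.
move=> Fz chZ.
have chS : determined_by (hist k k.+1) ch.
  by move=> w w' e; apply: chZ; exact: history_determined e.
pose N b w := m%:R^-1 * ((ch w)%:R * lyapunov_next z k b w).
have N0 b w : 0 <= N b w.
  by rewrite mulr_ge0 ?(ltW m_inv_gt0)// mulr_ge0 ?lyapunov_next_ge0.
have mN b : mfun (N b).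
  apply: (mhist (p := k) (q := k.+1)) => w w' e.
  by rewrite /N (chS _ _ e) (lyapunov_next_determined z b e).
(* Splitting by the value of [i k] leaves factors determined without that block, so each indicator
   is replaced by its probability [1/m]. *)
have next_avg : (expect P (fun w => (ch w)%:R * lyapunov z k.+1 w)%R =
    expect P (fun w => \sum_(b < m) N b w)%R)%E.
  have -> : (fun w => (ch w)%:R * lyapunov z k.+1 w) = (fun w => \sum_(b < m)
      (i k w == b)%:R * ((ch w)%:R * lyapunov_next z k b w)).
    apply/funext => w; rewrite lyapunovS (bigD1 (i k w))//= eqxx mul1r big1 ?addr0//.
    by move=> b bi; rewrite eq_sym (negbTE bi) mul0r.
  rewrite expect_sum; last 2 first.
  - move=> b; apply: (mhist (p := k.+1) (q := k.+1)) => w w' e.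
    have /historyP[ei _] := e; rewrite ei//.
    have {}e : hist k k.+1 w = hist k k.+1 w' by exact: history_determined e.
    by rewrite (chS _ _ e) (lyapunov_next_determined z b e).
  - by move=> b w; rewrite !mulr_ge0 ?lyapunov_next_ge0.
  rewrite expect_sum//; apply: eq_bigr => b _.
  have fZ : determined_by (hist k k.+1) (fun w => (ch w)%:R * lyapunov_next z k b w).
    by move=> w w' e; rewrite (chS _ _ e) (lyapunov_next_determined z b e).
  have f0 w : 0 <= (ch w)%:R * lyapunov_next z k b w.
    by rewrite mulr_ge0 ?lyapunov_next_ge0.
  rewrite expect_indicator (_ : [set w | _] = i k @^-1` [set b]); last first.
    by apply/seteqP; split=> w /eqP.
  rewrite (@integral_indep _ _ _ P _ _ (measurable_history ri rj k k.+1) _ _ _ fZ f0)//.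
  - by rewrite hi_unif /N expectZ ?(ltW m_inv_gt0)//; exact: mhist fZ.
  - by move=> w; rewrite history_indep_fst.
pose G w := (ch w)%:R * (gam * `|residual k (j k w) w| ^+ 2).
have G0 w : 0 <= G w by rewrite mulr_ge0// mulr_ge0 ?sqr_ge0// ltW.
have mG : mfun G.
  apply: (mhist (p := k) (q := k.+1)) => w w' e; rewrite /G (chS _ _ e).
  by have [xw ->] := iterates_determinedS e; rewrite (residual_eq _ xw).
pose F w := (ch w)%:R * (`|x k w - z| ^+ 2 +
  m%:R^-1 * \sum_(1 <= l < k.+1) tail_from a l.+1 * sqr_step (k - l) w).
have F0 w : 0 <= F w.
  rewrite mulr_ge0// addr_ge0 ?sqr_ge0// mulr_ge0 ?(ltW m_inv_gt0)//.
  by have := sum_tail_ge0 1 k w; under eq_bigr do rewrite addn1.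
have FZ : determined_by (hist k k) F.
  move=> w w' e; rewrite /F (chZ _ _ e); have xw := iterates_determined e.
  rewrite xw//; congr (_ * (_ + _ * _)).
  by apply: eq_big_nat => l lk; rewrite (sqr_step_eq xw).
(* The ordinal [l] stands for lag [l + 1], so [D l] below says that the current delay reaches that
   lag. *)
pose K (l : 'I_k) w := (ch w)%:R * (m%:R^-1 * (eps l.+1 * sqr_step (k - l.+1) w)).
have K0 l w : 0 <= K l w.
  by rewrite mulr_ge0// mulr_ge0 ?(ltW m_inv_gt0)// mulr_ge0 ?sqr_ge0// ltW// heps.
have KZ l : determined_by (hist k k) (K l).
  move=> w w' e; rewrite /K (chZ _ _ e); have xw := iterates_determined e.
  by rewrite (sqr_step_eq xw)//= ltn_ord.
have KZS l : determined_by (hist k k.+1) (K l).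
  by move=> w w' e; apply: KZ; exact: history_determined e.
pose D (l : nat) w : bool := (l < current_delay (j k w))%N.
have DZ l : determined_by (hist k k.+1) (D l).
  by move=> w w' e; rewrite /D; have [_ ->] := iterates_determinedS e.
have mDK (l : 'I_k) : mfun (fun w => (D l w)%:R * K l w).
  by apply: (mhist (p := k) (q := k.+1)) => w w' e; rewrite (DZ l _ _ e) (KZS l _ _ e).
have DK0 (l : 'I_k) w : 0 <= (D l w)%:R * K l w by rewrite mulr_ge0.
have tail_avg : (expect P (fun w => \sum_(l < k) (D l w)%:R * K l w)%R =
    expect P (fun w => \sum_(l < k) pl l.+1 * K l w)%R)%E.
  have pl0 := delay_tail_ge0.
  rewrite expect_sum// expect_sum//; last 2 first.
  - by move=> l; apply: (mhist (p := k) (q := k)) => w w' e; rewrite (KZ l _ _ e).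
  - by move=> l w; rewrite mulr_ge0.
  apply: eq_bigr => l _; rewrite expect_indicator.
  rewrite (@integral_indep _ _ _ P _ _ (measurable_history ri rj k k) _ _ _ (KZ l) (K0 l)).
  - by rewrite [X in (X * _)%E](prob_delay_ge k l.+1) expectZ//; exact: mhist (KZ l).
  - exact: (rj k [set v | (l < current_delay v)%N]).
  - move=> w; exact: (history_indep_snd mj hij k k [set v | (l < current_delay v)%N]).
have mF : mfun F by exact: mhist FZ.
have mDKs : mfun (fun w => \sum_(l < k) (D l w)%:R * K l w).
  apply: (mhist (p := k) (q := k.+1)) => w w' e; apply: eq_bigr => l _.
  by rewrite (DZ l _ _ e) (KZS l _ _ e).
have mpK : mfun (fun w => \sum_(l < k) pl l.+1 * K l w).
  by apply: (mhist (p := k) (q := k)) => w w' e; apply: eq_bigr => l _; rewrite (KZ l _ _ e).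
have mNs : mfun (fun w => \sum_(b < m) N b w).
  apply: (mhist (p := k) (q := k.+1)) => w w' e; apply: eq_bigr => b _.
  by rewrite /N (chS _ _ e) (lyapunov_next_determined z b e).
rewrite next_avg -/G -expectD//; last by move=> w; rewrite sumr_ge0.
(* By [tail_fromS], weight [l] is weight [l + 1], already in [F], plus [eps l * pl l], the averaged
   contribution of the delay. *)
rewrite (_ : (fun w => (ch w)%:R * lyapunov z k w) =
    (fun w => F w + \sum_(l < k) pl l.+1 * K l w)); last first.
  apply/funext => w; rewrite /F /K /lyapunov; case: (ch w); last first.
    by rewrite !mul0r add0r big1// => l _; rewrite mul0r mulr0.
  rewrite !mul1r -addrA; congr (_ + _); rewrite !big_add1/= !big_mkord.
  rewrite !mulr_sumr -big_split/=; apply: eq_bigr => l _.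
  by rewrite (tail_fromS a (isT : (1 <= l.+1)%N)) mul1r; ring.
have DKs0 w : 0 <= \sum_(l < k) (D l w)%:R * K l w by rewrite sumr_ge0.
have pKs0 w : 0 <= \sum_(l < k) pl l.+1 * K l w.
  by rewrite sumr_ge0// => l _; rewrite mulr_ge0// delay_tail_ge0.
rewrite (expectD P mF mpK)// -tail_avg -(expectD P mF mDKs)//.
apply: le_expect.
- apply: (mhist (p := k) (q := k.+1)) => w w' e; rewrite /N /G (chS _ _ e).
  have [xw ->] := iterates_determinedS e; rewrite (residual_eq _ xw).
  by congr (_ + _); apply: eq_bigr => b _; rewrite (lyapunov_next_determined z b e).
- apply: (mhist (p := k) (q := k.+1)) => w w' e; congr (_ + _).
    by apply: FZ; exact: history_determined e.
  by apply: eq_bigr => l _; rewrite (DZ l _ _ e) (KZS l _ _ e).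
- by move=> w; rewrite addr_ge0// sumr_ge0.
- move=> w; rewrite /N /G /F /K /D; case: (ch w); last first.
    by rewrite !mul0r add0r big1 ?add0r ?big1// => *; rewrite ?mul0r ?mulr0 ?mul0r.
  rewrite !mul1r -mulr_sumr; under eq_bigr do rewrite mul1r.
  apply: le_trans (lyapunov_next_descent k w Fz) _.
  rewrite lerD2l [in leLHS]big_add1/= big_mkord mulr_sumr; apply: ler_sum => l _.
  by rewrite mul1r; case: (l < _)%N; rewrite ?mulr1n ?mul1r// ?mulr0n mulr0 mul0r.
Qed.

Let mresidual k : mfun (fun w => gam * `|residual k (j k w) w| ^+ 2).
Proof.
apply: (mhist (p := k) (q := k.+1)) => w w' e.
by have [xw ->] := iterates_determinedS e; rewrite (residual_eq _ xw).
Qed.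

Let residual_ge0 k v w : 0 <= gam * `|residual k v w| ^+ 2.
Proof. by rewrite mulr_ge0 ?sqr_ge0// ltW. Qed.

Lemma expected_lyapunov z n : Fix T z ->
  (expect P (lyapunov z n) +
   \sum_(0 <= k < n) expect P (fun w => gam * `|residual k (j k w) w| ^+ 2)%R <=
   (`|x0 - z| ^+ 2)%:E)%E.
Proof.
move=> Fz; elim: n => [|n IH].
  rewrite big_geq// adde0 -(expect_cst P).
  rewrite (_ : lyapunov z 0 = cst (`|x0 - z| ^+ 2))//; apply/funext => w.
  by rewrite /lyapunov big_geq// mulr0 addr0; have [-> _] := hx w.
apply: le_trans IH; rewrite big_nat_recr//= [X in (_ + X <= _)%E]addeC addeA.
apply: leeD => //; have := @expected_descent z n (fun=> true) Fz (fun _ _ _ => erefl).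
have one (f : Omega -> R) : (fun w => true%:R * f w) = f.
  by apply/funext => w; rewrite mul1r.
by rewrite !one.
Qed.

Lemma sum_expected_residual z n : Fix T z ->
  (\sum_(0 <= k < n) expect P (fun w => gam * `|residual k (j k w) w| ^+ 2)%R <=
   (`|x0 - z| ^+ 2)%:E)%E.
Proof.
move=> Fz; apply: le_trans (expected_lyapunov n Fz); apply: leeDr.
by apply: expect_ge0 => w; exact: lyapunov_ge0.
Qed.

Lemma ae_lyapunov_cvg z : Fix T z -> {ae P, forall w, cvgn (lyapunov z ^~ w)}.
Proof.
move=> Fz; have mZ n b : measurable (hist n n @^-1` [set b]).
  exact: measurable_history.
apply: (@supermartingale_cvg _ _ _ P _ (fun n => hist n n) (lyapunov z) mZ _
  _ _ _ (`|x0 - z| ^+ 2)).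
- by move=> n; exact: history_determined.
- exact: lyapunov_determined.
- exact: lyapunov_ge0.
- move=> n ch chZ; apply: le_trans (expected_descent Fz chZ); apply: leeDl.
  by apply: expect_ge0 => w; rewrite mulr_ge0.
- move=> n; apply: le_trans (expected_lyapunov n Fz); apply: leeDl.
  by apply: sume_ge0 => k _; apply: expect_ge0.
Qed.

Lemma ae_residual_cvg0 z : Fix T z ->
  {ae P, forall w, residual k (j k w) w @[k --> \oo] --> 0}.
Proof.
move=> Fz.
have := ae_cvg0_of_summable mresidual (fun k w => residual_ge0 k (j k w) w)
  (fun n => sum_expected_residual n Fz).
by apply: filterS => w; exact: cvg0_of_scaled_sqr.
Qed.

(** There are countably many delay vectors; were each of probability zero, the whole space would be
    null. *)
Lemma possible_delay_exists : exists v, P (j 0%N @^-1` [set v]) != 0%E.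
Proof.
apply: contrapT => nv.
have nul v : P (j 0%N @^-1` [set v]) = 0%E.
  by apply/eqP; apply: contrapT => /negP h; apply: nv; exists v.
have : {ae P, forall w, forall n : nat, choice.unpickle n <> Some (j 0%N w)}.
  apply: ae_foralln => n; case: (choice.unpickle n) => [v|]; last exact: aeW.
  exists (j 0%N @^-1` [set v]); split; [exact: rj|exact: nul|].
  by move=> w /= /contrapT [->].
move=> [N [mN PN]]; rewrite (_ : ~` _ = setT); last first.
  apply/seteqP; split=> // w _ /= h; apply: (h (choice.pickle (j 0%N w))).
  exact: choice.pickleK.
rewrite subTset => NT; move: PN; rewrite NT => P0.
by have := @probability_setT _ _ _ P; rewrite P0 => /eqP; rewrite eq_sym onee_eq0.
Qed.

(* j k is independent of the past, so along any delay vector v of positive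
   probability the residuals are square summable as well. *)
Lemma ae_fixed_delay_residual_cvg0 v z : Fix T z -> P (j 0%N @^-1` [set v]) != 0%E ->
  {ae P, forall w, residual k v w @[k --> \oo] --> 0}.
Proof.
move=> Fz Pv; pose p := fine (P (j 0%N @^-1` [set v])).
have mv k : measurable (j k @^-1` [set v]) by exact: rj.
have Pp k : P (j k @^-1` [set v]) = p%:E.
  rewrite /p fineK ?fin_num_measure//.
  by case: hj_iid => _ _ /(_ k 0%N [set v]).
have p0 : 0 < p.
  by rewrite lt_neqAle eq_sym -eqe -(Pp 0%N) Pv/= fine_ge0.
have rZ k : determined_by (hist k k) (fun w => gam * `|residual k v w| ^+ 2).
  by move=> w w' /iterates_determined xw; rewrite (residual_eq _ xw).
pose f k w := p * (gam * `|residual k v w| ^+ 2).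
have f0 k w : 0 <= f k w by rewrite mulr_ge0// ltW.
have mf k : mfun (f k).
  by apply: (mhist (p := k) (q := k)) => w w' e; rewrite /f (rZ k _ _ e).
have hs n : (\sum_(0 <= k < n) expect P (f k) <= (`|x0 - z| ^+ 2)%:E)%E.
  apply: le_trans (sum_expected_residual n Fz); apply: lee_sum => k _.
  rewrite /f expectZ ?(ltW p0)//; last exact: mhist (rZ k).
  rewrite -(Pp k) -(@integral_indep _ _ _ P _ _ (measurable_history ri rj k k)
    _ _ (mv k) (rZ k))//; last first.
    by move=> w; rewrite history_indep_snd.
  rewrite (_ : j k @^-1` [set v] = [set w | j k w == v]); last first.
    by apply/seteqP; split=> w /eqP.
  rewrite -expect_indicator; apply: le_expect => //.
  - apply: (mhist (p := k) (q := k.+1)) => w w' e.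
    by have [xw ->] := iterates_determinedS e; rewrite (residual_eq _ xw).
  - by move=> w; rewrite mulr_ge0.
  - by move=> w; case: eqP => [->|_]; rewrite ?mul1r ?mul0r.
have := ae_cvg0_of_summable mf f0 hs; apply: filterS => w.
rewrite /f; under eq_fun do rewrite mulrA.
by apply: cvg0_of_scaled_sqr; rewrite mulr_gt0.
Qed.

(** * Deterministic limits along one sample path *)

Section sample_path.
Variables (w : Omega) (v : {ffun 'I_m -> nat}).
Hypothesis res_cvg0 : residual k (j k w) w @[k --> \oo] --> 0.
Hypothesis res_v_cvg0 : residual k v w @[k --> \oo] --> 0.

Let step_cvg0 : x n.+1 w - x n w @[n --> \oo] --> 0.
Proof.
apply/cvgr0Pnorm_le => e e0; have ee : 0 < e / et by rewrite divr_gt0.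
move/cvgr0Pnorm_le : res_cvg0 => /(_ _ ee); apply: filterS => n h.
rewrite arock_next addrAC subrr sub0r normrN normrZ gtr0_norm//.
rewrite -ler_pdivlMl// mulrC (le_trans _ h)//; exact: (norm_pr hip hdec).
Qed.

Lemma sqr_step_cvg0 : sqr_step n w @[n --> \oo] --> 0.
Proof.
have h : `|x n.+1 w - x n w| @[n --> \oo] --> 0.
  by rewrite -(normr0 H); exact: cvg_norm step_cvg0.
rewrite -(mulr0 (0 : R)) /sqr_step; under eq_fun do rewrite expr2.
exact: cvgM.
Qed.

Lemma delayed_step_cvg0 q : x k w - x (k - q)%N w @[k --> \oo] --> 0.
Proof.
elim: q => [|q IH].
  by under eq_fun do rewrite subn0 subrr; exact: cvg_cst.
apply/cvgr0Pnorm_le => e e0; have e2 : 0 < e / 2 by rewrite divr_gt0.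
move/cvgr0Pnorm_le : IH => /(_ _ e2) [N1 _ h1].
move/cvgr0Pnorm_le : step_cvg0 => /(_ _ e2) [N2 _ h2].
(* The summand [q.+1] ensures [q < k], so that the truncated subtractions are genuine. *)
exists (N1 + N2 + q.+1)%N => // k /= Nk.
rewrite -[x k w](subrK (x (k - q)%N w)) -addrA [leRHS]splitr.
rewrite (le_trans (ler_normD _ _))// lerD//.
  by apply: h1 => /=; rewrite (leq_trans _ Nk)// -addnA leq_addr.
have qk : (q < k)%N by rewrite (leq_trans _ Nk)// leq_addl.
rewrite -(subnSK qk); apply: h2 => /=.
by rewrite leq_subRL// (leq_trans _ Nk)// addnC leq_add2r leq_addl.
Qed.

Lemma iterate_residual_cvg0 : x k w - T (x k w) @[k --> \oo] --> 0.
Proof.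
pose xh k := delayed_iterate pr (x ^~ w) k v.
(* Only the finitely many fixed lags [v b] occur, so the difference vanishes block by block. *)
have hxh : x k w - xh k @[k --> \oo] --> 0.
  rewrite (_ : (fun k => _) = fun k => \sum_b pr b (x k w - x (k - v b)%N w)).
    rewrite -[X in _ --> X](_ : \sum_(b < m) (0 : H) = 0); last by rewrite big1.
    apply: cvg_big => [|b _]; first exact: add_continuous.
    apply/cvgr0Pnorm_le => e e0.
    have /cvgr0Pnorm_le/(_ _ e0) := delayed_step_cvg0 (v b).
    by apply: filterS => k; apply: le_trans; exact: (norm_pr hip hdec).
  apply/funext => k; rewrite -[x k w in LHS](pr_sum hdec) -sumrB.
  by apply: eq_bigr => b _; rewrite (prB hip hdec).
apply/cvgr0Pnorm_le => e e0; have e3 : 0 < e / 3 by rewrite divr_gt0.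
move/cvgr0Pnorm_le : hxh => /(_ _ e3) h1.
move/cvgr0Pnorm_le : res_v_cvg0 => /(_ _ e3); apply: filterS2 h1 => k h1 h2.
have h3 : `|T (xh k) - T (x k w)| <= e / 3.
  by rewrite (le_trans (hT _ _))// distrC.
have -> : x k w - T (x k w) =
    (x k w - xh k) + ((xh k - T (xh k)) + (T (xh k) - T (x k w))).
  by rewrite !addrA !subrK.
have := ler_normD (x k w - xh k) ((xh k - T (xh k)) + (T (xh k) - T (x k w))).
have := ler_normD (xh k - T (xh k)) (T (xh k) - T (x k w)).
move: h1 h2 h3; rewrite /residual -/(xh k); lra.
Qed.

(** The memory term is a convolution of summable weights with vanishing squared steps, hence tends
    to zero and leaves [|x k w - z|^2] convergent. *)
Lemma dist_cvg_of_lyapunov z : cvgn (lyapunov z ^~ w) -> cvgn (fun k => `|x k w - z|).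
Proof.
move=> cl.
have tail0 l : (1 <= l)%N -> 0 <= tail_from a l by move=> _; exact: tail_from_ge0.
have conv := convolution_cvg0 tail0 (fun n => sum_tail_from n a_ge0 sa heps_tail)
  (fun n => sqr_ge0 _) sqr_step_cvg0.
have c2 : cvgn (fun k => `|x k w - z| ^+ 2).
  rewrite (_ : (fun k => _) = (fun k => lyapunov z k w -
      m%:R^-1 * \sum_(1 <= l < k.+1) tail_from a l * sqr_step (k - l) w)).
    apply: is_cvgB => //; apply/cvg_ex; exists (m%:R^-1 * 0).
    by apply: cvgM => //; exact: cvg_cst.
  by apply/funext => k; rewrite /lyapunov addrK.
rewrite (_ : (fun k => _) = (fun k => Num.sqrt (`|x k w - z| ^+ 2))).
  have [l hl] := (cvg_ex _).1 c2; apply/cvg_ex; exists (Num.sqrt l).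
  exact: continuous_cvg (@sqrt_continuous _ l) hl.
by apply/funext => k; rewrite sqrtr_sqr normr_id.
Qed.

End sample_path.

(** The null set for the Lyapunov limit depends on [z]. Separability gives a countable dense set of
    fixed points, hence one common null set, and the closure argument recovers every fixed point. *)
Lemma ae_weak_convergence : separable H -> Fix T !=set0 ->
  {ae P, forall w, exists2 z, Fix T z & weakly_converges ip (x ^~ w) z}.
Proof.
move=> hsep hFix; have [z0 Fz0] := hFix.
have [q Fq dq] := separable_subset hsep hFix.
have [v Pv] := possible_delay_exists.
have lq : {ae P, forall w, forall n k, cvgn (lyapunov (q n k) ^~ w)}.
  by apply: ae_foralln => n; apply: ae_foralln => k; exact: ae_lyapunov_cvg.
have := ae_fixed_delay_residual_cvg0 Fz0 Pv.
apply: filterS3 lq (ae_residual_cvg0 Fz0) => w hl hr hv.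
apply: (weak_cvg_of_dist_cvg hip hT hFix (iterate_residual_cvg0 hr hv)) => z Fz.
apply: cvg_dist_closure (dq _ Fz) => _ [n _ [k _ <-]].
exact: dist_cvg_of_lyapunov.
Qed.

End arock_convergence.

Theorem theorem4 (R : realType) (H : completeNormedModType R)
    (ip : {dot H for idfun}) (m : nat)
    (V : 'I_m -> set H) (pr : 'I_m -> H -> H) (T : H -> H)
    (d : measure_display) (Omega : measurableType d) (P : probability Omega R)
    (i : nat -> Omega -> 'I_m) (j : nat -> Omega -> {ffun 'I_m -> nat})
    (eps : nat -> R) (c : R) (eta : nat -> R) (x0 : H) (x : nat -> Omega -> H)
    (hip : inner_product ip)
    (hsep : separable H)
    (hdec : orthogonal_decomposition ip V pr)
    (hT : nonexpansive T)
    (hFix : Fix T !=set0)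
    (hi_iid : iid P i)
    (hi_unif : forall (k : nat) (b : 'I_m), P (i k @^-1` [set b]) = (m%:R^-1)%:E)
    (hj_iid : iid P j)
    (hj_even : evenly_old P j)
    (hij : independent_sequences P i j)
    (heps : forall l : nat, (1 <= l)%N -> 0 < eps l)
    (heps_inv : summable_from1 (fun l => (eps l)^-1))
    (heps_tail : summable_from1 (fun l => eps l * delay_tail P j l * l%:R))
    (hc : 0 < c < 1)
    (heta : forall k, eta k = c * step_bound m eps (delay_tail P j))
    (hx : forall w, arock pr T eta (i ^~ w) (j ^~ w) x0 (x ^~ w)) :
  {ae P, forall w, exists2 z, Fix T z & weakly_converges ip (x ^~ w) z}.
Proof.
have etaE : eta = fun=> c * step_bound m eps (delay_tail P j).
  exact/funext/heta.
have {}hx w : arock pr T (fun=> c * step_bound m eps (delay_tail P j))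
    (i ^~ w) (j ^~ w) x0 (x ^~ w) by rewrite -etaE.
exact: (ae_weak_convergence hip hdec hT hi_iid hi_unif hj_iid hij heps heps_inv
  heps_tail hc hx hsep hFix).
Qed.
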